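(* Let $B$ be a standard Brownian motion, $\beta>0$, and $$\Gamma_t=\frac{e^{B_t-t/2}}{1+\beta\int_0^te^{B_s-s/2}\,ds}.$$ Let $R$ be a hyperbolic Bessel process with parameter $\alpha=-1$, i.e. a diffusion solving $dR_t=dW_t-\tfrac12\coth(R_t)\,dt$ with $W$ a standard Brownian motion. Then for every $\lambda\ge0$ and $t\ge0$, $$\mathbb{E}e^{-\lambda\Gamma_t}=\mathbb{E}e^{-\beta(\cosh(R_t)-1)},$$ where the initial value of $R$ satisfies $\cosh(R_0)=\frac{\lambda}{\beta}+1$.
   Context: A hyperbolic Bessel process with parameter $\alpha\in\mathbb{R}$ is the diffusion with generator $\frac12\frac{d^2}{dx^2}+(\alpha+\frac12)\coth(x)\frac{d}{dx}$, i.e. solving $dR_t=dW_t+(\alpha+\frac12)\coth(R_t)\,dt$. *)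

(* Defs.v *)
From HB Require Import structures.
From mathcomp Require Import all_boot all_order all_algebra.
From mathcomp Require Import all_classical all_reals all_analysis.
Set Implicit Arguments. Unset Strict Implicit. Unset Printing Implicit Defensive.
Import Order.TTheory GRing.Theory Num.Theory.
Import numFieldNormedType.Exports.
Local Open Scope classical_set_scope.
Local Open Scope ring_scope.

Section defs.
Variable R : realType.

Definition coshR (x : R) : R := (expR x + expR (- x)) / 2.
Definition sinhR (x : R) : R := (expR x - expR (- x)) / 2.
Definition cothR (x : R) : R := coshR x / sinhR x.

Definition brownian_motion d (Omega : measurableType d)
    (P : probability Omega R) (B : R -> Omega -> R) : Prop :=
  [/\ (forall t, measurable_fun setT (B t)),
      {ae P, forall w, B 0 w = 0 /\
         {within [set t | 0 <= t], continuous (fun t => B t w)}},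
      (forall s t (A : set R), 0 <= s -> s < t -> measurable A ->
         P [set w | B t w - B s w \in A] = normal_prob 0 (Num.sqrt (t - s)) A) &
      (forall (n : nat) (ts : nat -> R) (A : nat -> set R),
         0 <= ts 0%N -> (forall i, (i < n)%N -> ts i < ts i.+1) ->
         (forall i, measurable (A i)) ->
         P (\bigcap_(i in `I_n) [set w | B (ts i.+1) w - B (ts i) w \in A i])
         = (\prod_(i < n) P [set w | (B (ts i.+1) w - B (ts i) w)%R \in A i])%E)].

Definition Gamma_proc d (Omega : measurableType d) (beta : R)
    (B : R -> Omega -> R) (t : R) (w : Omega) : R :=
  expR (B t w - t / 2) /
  (1 + beta * fine (\int[lebesgue_measure]_(s in `[0%R, t]%classic) (expR (B s w - s / 2))%:E)%E).

(* X is a hyperbolic Bessel process with parameter alpha driven by the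
   Brownian motion W (on the same probability space), i.e. a nonnegative
   continuous solution of dX_t = dW_t + (alpha + 1/2) coth(X_t) dt, absorbed
   at 0 once it hits 0.  Since the noise is additive, the SDE is the pathwise
   integral equation
     X_t = X_0 + W_t + int_0^t (alpha+1/2) coth(X_s) ds
   (valid as long as X has stayed positive on [0,t]). *)
Definition hyperbolic_bessel d (Omega : measurableType d)
    (P : probability Omega R) (alpha : R) (W X : R -> Omega -> R) : Prop :=
  [/\ brownian_motion P W,
      (forall t, measurable_fun setT (X t)) &
      {ae P, forall w,
        [/\ {within [set t | 0 <= t], continuous (fun t => X t w)},
            (forall t, 0 <= t -> 0 <= X t w),
            (forall s t, 0 <= s -> s <= t -> X s w = 0 -> X t w = 0) &
            (forall t, 0 <= t -> (forall s, 0 <= s <= t -> 0 < X s w) ->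
               X t w = X 0 w + W t w +
                 fine (\int[lebesgue_measure]_(s in `[0%R, t]%classic)
                        ((alpha + 2^-1) * cothR (X s w))%:E)%E)]}].

End defs.

(* Main.v *)
Require Import Defs.
From HB Require Import structures.
From mathcomp Require Import all_boot all_order all_algebra.
From mathcomp Require Import all_classical all_reals all_analysis.
From mathcomp Require Import measurable_realfun.
From mathcomp Require Import ring lra.
Set Implicit Arguments.
Unset Strict Implicit.
Unset Printing Implicit Defensive.
Import Order.TTheory GRing.Theory Num.Theory.
Import numFieldNormedType.Exports.
Local Open Scope classical_set_scope.
Local Open Scope ring_scope.

(** The proof is a discretized duality argument.  With [Y := beta (cosh X - 1)],
    the function [exp (- g y)] satisfies [L_Gamma exp (- g y) = L_Y exp (- g y)],
    where [L_Gamma = g^2/2 d^2/dg^2 - beta g^2 d/dg] and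
    [L_Y = (y^2/2 + beta y) d^2/dy^2] are the generators of [Gamma] and [Y].
    On a grid of mesh [h], [Gamma] is approximated by the chain
    [g' = g exp (dB - h/2) / (1 + beta h g)] (left Riemann sums) and [X] by an
    Euler scheme stopped below a level [eps]; since the noise is additive, the
    latter converges for every single path.  The equality of the generators
    becomes a one-step error [O(h sqrt h)], uniform in [g] and in [x >= eps],
    between the two Gaussian kernels applied to [exp (- g y)], and exchanging
    the steps of the two independent chains one at a time gives a total error
    [O(sqrt h)] plus [O(eps^2)] for the stopping.  Letting first [h] and then
    [eps] tend to [0] yields the theorem. *)

(** * Elementary exponential estimates *)

Section exp_estimates.
Context {R : realType}.
Implicit Types a b h m q r v x y z : R.

(** [Y] has no drift: [- coth / 2] is exactly the drift that kills the term [cosh / 2] of Ito's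
    formula for [cosh X], while [d<Y> = beta ^ 2 sinh ^ 2 X dt = (Y ^ 2 + 2 beta Y) dt]. No
    stochastic calculus enters: on a grid both chains are functions of iid Gaussian increments, and
    only Gaussian integrals of exponentials are computed. Uniformity in [g] comes from the scaling
    [a = g y]: only products [a ^ n expR (- a)] occur, and these are bounded. In [x] there is no
    uniformity near 0, where the relative fluctuation of [cosh X - 1] over one step is governed by
    [1 / (cosh x - 1)]; hence the stopping at [eps], with constants that depend on [eps], and hence
    the limit in [h] before the limit in [eps]. Stopping costs at most the potential at [eps]:
    replacing [E expR (- G y)] by 1 makes an error between 0 and [y E G <= y], because the chain for
    [Gamma] is a supermartingale started at 1. The order [h sqrt h] is that of the third absolute
    moment of a Gaussian increment. *)

Lemma normr_expRB1Dx_le m r : `|r| <= m -> `|expR r - 1 - r| <= r ^+ 2 * expR m.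
Proof.
move=> rm; have e1 := expR_ge1Dx r.
rewrite ger0_norm; last by lra.
have e2 : 1 - r <= expR (- r) by exact: expR_ge1Dx.
have e3 : expR r * expR (- r) = 1 by exact: expRxMexpNx_1.
have e0 := expR_gt0 r.
have m1 : 1 <= expR m.
  by apply: le_trans (expR_ge1Dx m); rewrite lerDl; apply: le_trans rm.
have e4 : expR r - 1 <= r * expR r by nra.
have [r0|r0] := leP 0 r.
  have : expR r <= expR m by rewrite ler_expR (le_trans (ler_norm _) rm).
  move=> rm'.
  have : expR r - 1 - r <= r ^+ 2 * expR r by nra.
  move=> /le_trans; apply; rewrite ler_wpM2l// sqr_ge0//.
have : expR r - 1 - r <= r ^+ 2 by nra.
by move=> /le_trans; apply; rewrite ler_peMr// sqr_ge0.
Qed.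

Lemma is_derive_lipschitz (f df : R -> R) (h C : R) : 0 <= h ->
  (forall s, 0 <= s <= h -> is_derive s 1 f (df s)) ->
  (forall s, 0 <= s <= h -> `|df s| <= C) -> `|f h - f 0| <= C * h.
Proof.
move=> h0 fdf dfC.
have [||c /itvP hc ->] := @MVT_segment R f df 0 h h0.
- by move=> s; rewrite in_itv/= => /andP[s0 sh]; apply: fdf; rewrite !ltW.
- apply: derivable_within_continuous => s; rewrite in_itv/= => sh.
  by have [] := fdf s sh.
by rewrite subr0 normrM (ger0_norm h0) ler_wpM2r// dfC// !hc.
Qed.

(** The first-order remainder is integrated along the ray [s * x]. The exponent is the positive part
    of [x] and not [|x|]: the bound is used at [x = - a (q - 1)] against a factor [expR (- a)], with
    [q] arbitrarily large, where [expR |x|] would not be compensated. *)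
Lemma normr_expRB_taylor2_le x :
  `|expR x - 1 - x - x ^+ 2 / 2| <= `|x| ^+ 3 * expR (Num.max x 0).
Proof.
pose F s := expR (s * x) - 1 - s * x - (s * x) ^+ 2 / 2.
have -> : expR x - 1 - x - x ^+ 2 / 2 = F 1 - F 0.
  by rewrite /F !mul1r !mul0r expR0; lra.
rewrite -[leRHS]mulr1.
apply: (@is_derive_lipschitz F (fun s => x * (expR (s * x) - 1 - s * x))) => //.
  by move=> s _; apply: is_derive_eq; rewrite /GRing.scale/=; lra.
move=> s /andP[s0 s1].
rewrite normrM exprS -mulrA ler_wpM2l//.
have sx : `|s * x| <= `|x| by rewrite normrM ger0_norm// ler_piMl.
have [x0|x0] := leP 0 x.
  rewrite (le_trans (normr_expRB1Dx_le (lexx _)))//.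
  rewrite real_normK ?num_real//; apply: ler_pM; rewrite ?sqr_ge0 ?expR_ge0//.
    by rewrite exprMn ler_piMl ?sqr_ge0// expr_le1.
  by rewrite ler_expR (le_trans sx)// ger0_norm// le_max lexx.
have e1 := expR_ge1Dx (s * x).
rewrite ger0_norm; last by lra.
have sx0 : s * x <= 0 by nra.
have e2 : expR (s * x) <= 1 by rewrite expR_le1.
have e3 := expR_ge1Dx (- (s * x)).
have e4 : expR (s * x) * expR (- (s * x)) = 1 by exact: expRxMexpNx_1.
have e0 := expR_gt0 (s * x).
rewrite real_normK ?num_real// expR0 mulr1.
apply: (@le_trans _ _ ((s * x) ^+ 2)); first by nra.
by rewrite exprMn ler_piMl ?sqr_ge0// expr_le1.
Qed.

(** The [n]-th power of [v / n <= expR (v / n)]. It is the source of the bounds 1, 4, 27 and 256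
    below. *)
Lemma exprn_mul_expRN_le v n : 0 <= v -> v ^+ n * expR (- v) <= (n ^ n)%:R.
Proof.
move=> v0; case: n => [|n]; first by rewrite mul1r expR_le1 oppr_le0.
have : v / n.+1%:R <= expR (v / n.+1%:R).
  by apply: le_trans (expR_ge1Dx _); rewrite lerDr.
move=> /(lerXn2r n.+1); rewrite !nnegrE expR_ge0 divr_ge0// => /(_ isT isT).
rewrite -expRM_natr divfK ?pnatr_eq0// expr_div_n ler_pdivrMr ?exprn_gt0//.
by rewrite expRN natrX ler_pdivrMr ?expR_gt0// mulrC.
Qed.

(** The bound is uniform in [a]. For [q >= 1/2], the product of [expR (- a)] with the exponential of
    the Taylor remainder is at most [expR (- (a / 2))], and
    [a ^ 3 expR (- (a / 2)) <= 8 * 27 = 216]. For [q < 1/2], the right-hand side is at least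
    [216 / 8 = 27], more than the crude bound [1 + 4] of the left-hand side. *)
Lemma normr_expRNM_taylor2_le a q : 0 <= a -> 0 <= q ->
  `|expR (- (a * q)) -
    expR (- a) * (1 - a * (q - 1) + a ^+ 2 * (q - 1) ^+ 2 / 2)|
  <= 216 * `|q - 1| ^+ 3.
Proof.
move=> a0 q0; have [q12|q12] := leP (1 / 2) q.
  have -> : expR (- (a * q)) = expR (- a) * expR (- a * (q - 1)).
    by rewrite -expRD; congr expR; lra.
  rewrite [X in `|X|](_ : _ = expR (- a) * (expR (- a * (q - 1)) - 1
    - (- a * (q - 1)) - (- a * (q - 1)) ^+ 2 / 2)); last by lra.
  rewrite normrM ger0_norm ?expR_ge0//.
  apply: le_trans (ler_wpM2l (expR_ge0 _) (normr_expRB_taylor2_le _)) _.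
  rewrite normrM normrN (ger0_norm a0) exprMn.
  rewrite [leLHS](_ : _ = `|q - 1| ^+ 3 *
    (a ^+ 3 * (expR (- a) * expR (Num.max (- a * (q - 1)) 0)))); last by ring.
  rewrite [leRHS]mulrC ler_wpM2l ?exprn_ge0//.
  apply: (@le_trans _ _ (a ^+ 3 * expR (- (a / 2)))).
    rewrite ler_wpM2l ?exprn_ge0// -expRD ler_expR.
    by rewrite -lerBrDl ge_max; apply/andP; split; nra.
  have a20 : 0 <= a / 2 by lra.
  have e3 : (a / 2) ^+ 3 * expR (- (a / 2)) <= 27 := exprn_mul_expRN_le 3 a20.
  lra.
have d0 : `|q - 1| = 1 - q by rewrite ler0_norm; lra.
have d3 : 1 / 8 <= `|q - 1| ^+ 3 by rewrite d0; nra.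
have b1 : `|expR (- (a * q))| <= 1.
  by rewrite ger0_norm ?expR_ge0// expR_le1 oppr_le0 mulr_ge0.
have v0 := expR_gt0 (- a).
have v1 : expR (- a) <= 1 by rewrite expR_le1 oppr_le0.
have v2 : a * expR (- a) <= 1 := exprn_mul_expRN_le 1 a0.
have v3 : a ^+ 2 * expR (- a) <= 4 := exprn_mul_expRN_le 2 a0.
have b2 : `|expR (- a) * (1 - a * (q - 1) + a ^+ 2 * (q - 1) ^+ 2 / 2)| <= 4.
  rewrite ger0_norm; last first.
    apply: mulr_ge0; first exact: ltW.
    have aq : a * (q - 1) <= 0 by nra.
    by have := sqr_ge0 (a * (q - 1)); lra.
  have w : (1 - q) ^+ 2 <= 1 by nra.
  have w0 : 0 <= (1 - q) ^+ 2 by exact: sqr_ge0.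
  have k1 : a * expR (- a) * (1 - q) <= 1 by nra.
  have k2 : a ^+ 2 * expR (- a) * (1 - q) ^+ 2 <= 4.
    by rewrite -[leRHS]mulr1; apply: ler_pM => //; rewrite mulr_ge0 ?sqr_ge0// ltW.
  rewrite [leLHS](_ : _ = expR (- a) + a * expR (- a) * (1 - q)
    + (a ^+ 2 * expR (- a) * (1 - q) ^+ 2) / 2); last by field.
  lra.
rewrite (le_trans (ler_normB _ _))//; lra.
Qed.

End exp_estimates.

Section harmonic_flow.
Context {R : realType}.
Implicit Types a k h s : R.

(* [v s := a / (1 + s k a)] solves [v' = - k v ^ 2], so that all derivatives of
   [expR (- v s)] in [s] are polynomials in [v] times [expR (- v)], hence
   bounded uniformly in [a]. *)
Lemma expRN_harmonic_taylor_le a k h v :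
  0 <= a -> 0 <= k -> 0 <= h <= 1 -> v = a / (1 + h * k * a) ->
  `|expR (- v) * (1 + v ^+ 2 / 2 * (expR h - 1))
    - expR (- a) * (1 + h * k * a ^+ 2 + a ^+ 2 * h / 2)|
  <= (310 * k ^+ 2 + 2 * expR 1 + 155 * k) * h ^+ 2.
Proof.
move=> a0 k0 /andP[h0 h1] vE.
pose V s := a * (1 + s * (k * a))^-1.
pose G s := V s ^+ 2 * expR (- V s).
have den s : 0 <= s -> 0 < 1 + s * (k * a).
  by move=> s0; rewrite ltr_pwDl// !mulr_ge0.
have V0 s : 0 <= s -> 0 <= V s.
  by move=> s0; rewrite mulr_ge0// invr_ge0 ltW// den.
have dV s : 0 <= s -> is_derive s 1 V (- k * V s ^+ 2).
  move=> s0; have d0 := lt0r_neq0 (den _ s0).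
  rewrite /V.
  apply: is_derive_eq; rewrite /GRing.scale/=.
  by field.
have dF s : 0 <= s -> is_derive s 1 (fun s => expR (- V s)) (k * G s).
  move=> s0; have ? := dV s s0.
  by apply: is_derive_eq; rewrite /G /GRing.scale/=; ring.
have dG s : 0 <= s ->
    is_derive s 1 G (- k * (2 * V s ^+ 3 - V s ^+ 4) * expR (- V s)).
  move=> s0; have ? := dV s s0.
  by apply: is_derive_eq; rewrite /GRing.scale/=; ring.
(* The constant is [2 * 27 + 256], from the bounds on [V ^ 3 expR (- V)] and [V ^ 4 expR (- V)]. *)
have GB s : 0 <= s <= h -> `|G s - G 0| <= 310 * k * s.
  move=> /andP[s0 sh]; apply: (is_derive_lipschitz s0).
    by move=> r /andP[r0 _]; exact: dG.
  move=> r /andP[r0 rs]; rewrite -mulrA normrM normrN (ger0_norm k0) mulrC.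
  rewrite ler_wpM2r//.
  have e3 : V r ^+ 3 * expR (- V r) <= 27 := exprn_mul_expRN_le 3 (V0 _ r0).
  have e4 : V r ^+ 4 * expR (- V r) <= 256 := exprn_mul_expRN_le 4 (V0 _ r0).
  have p3 : 0 <= V r ^+ 3 * expR (- V r) by rewrite mulr_ge0 ?expR_ge0 ?exprn_ge0 ?V0.
  have p4 : 0 <= V r ^+ 4 * expR (- V r) by rewrite mulr_ge0 ?expR_ge0 ?exprn_ge0 ?V0.
  by rewrite ler_norml; apply/andP; split; lra.
have FB : `|expR (- V h) - expR (- V 0) - h * (k * G 0)| <= 310 * k ^+ 2 * h * h.
  pose H s := expR (- V s) - s * (k * G 0).
  have -> : expR (- V h) - expR (- V 0) - h * (k * G 0) = H h - H 0.
    by rewrite /H; ring.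
  apply: (@is_derive_lipschitz _ H (fun s => k * (G s - G 0))) => //.
    move=> s /andP[s0 _]; have ? := dF s s0.
    by apply: is_derive_eq; rewrite /GRing.scale/=; ring.
  move=> s /andP[s0 sh]; rewrite normrM ger0_norm//.
  rewrite expr2 [leRHS](_ : _ = k * (310 * k * h)); last by ring.
  rewrite ler_wpM2l// (le_trans (GB s _)) ?s0//.
  by rewrite ler_wpM2l// mulr_ge0.
have hh : 0 <= h <= h by rewrite h0/=.
have Gh : G h <= 4 := exprn_mul_expRN_le 2 (V0 _ h0).
have Gh0 : 0 <= G h by rewrite mulr_ge0 ?expR_ge0 ?sqr_ge0.
have eh : `|expR h - 1 - h| <= h ^+ 2 * expR 1.
  by apply: normr_expRB1Dx_le; rewrite ger0_norm.
have G0 : G 0 = a ^+ 2 * expR (- a) by rewrite /G /V mul0r addr0 invr1 mulr1.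
have F0 : expR (- V 0) = expR (- a) by rewrite /V mul0r addr0 invr1 mulr1.
have Vh : v = V h by rewrite vE /V -mulrA.
rewrite Vh; have := GB h hh; move: FB; rewrite F0 => FB GBh.
(* The flow itself produces the term [h k a ^ 2]; in the rest, [expR h - 1] is replaced by [h] and
   the coefficient [G] is moved from time [h] back to time 0. *)
rewrite [X in `|X|](_ : _ = (expR (- V h) - expR (- a) - h * (k * G 0)) +
  (G h * (expR h - 1 - h) + (G h - G 0) * h) / 2); last first.
  by rewrite G0 /G; field.
rewrite (le_trans (ler_normD _ _))//.
rewrite [leRHS](_ : _ = 310 * k ^+ 2 * h * h +
  (4 * (h ^+ 2 * expR 1) + 310 * k * h * h) / 2); last by field.
rewrite lerD// normrM [X in _ * X]gtr0_norm// ler_wpM2r//.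
rewrite (le_trans (ler_normD _ _))// lerD//.
  by rewrite normrM (ger0_norm Gh0) ler_pM.
by rewrite normrM (ger0_norm h0) ler_wpM2r.
Qed.

End harmonic_flow.

Section normal_exponential_moments.
Context {R : realType}.
Implicit Types c h m s : R.
Local Notation mu := (@lebesgue_measure R).

(** The density and the Radon-Nikodym derivative of [normal_prob] have equal integrals over all
    measurable sets, so they agree almost everywhere. *)
Lemma ge0_integral_normal_prob m s (f : R -> \bar R) :
  (forall x, 0 <= f x)%E -> measurable_fun [set: R] f ->
  (\int[normal_prob m s]_x f x = \int[mu]_x (f x * (normal_pdf m s x)%:E))%E.
Proof.
move=> f0 mf.
have dom := normal_prob_dominates m s.
rewrite -(Radon_Nikodym_SigmaFinite.change_of_variables dom)//.
apply: ae_eq_integral => //.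
- apply: emeasurable_funM => //.
  exact: measurable_int (Radon_Nikodym_SigmaFinite.f_integrable dom).
- apply: emeasurable_funM => //.
  by apply/measurable_EFinP; exact: measurable_normal_pdf.
apply: ae_eqe_mul2l; apply: integral_ae_eq => //.
- exact: Radon_Nikodym_SigmaFinite.f_integrable.
- by apply/measurable_EFinP; exact: measurable_normal_pdf.
- by move=> A _ mA; rewrite -Radon_Nikodym_SigmaFinite.f_integral.
Qed.

Lemma integral_normal_expR h c m : 0 < h ->
  (\int[normal_prob 0 (Num.sqrt h)]_z (expR (c * z + m))%:E =
   (expR (c ^+ 2 * h / 2 + m))%:E)%E.
Proof.
move=> h0; have sh0 : Num.sqrt h != 0 by rewrite gt_eqF// sqrtr_gt0.
have mexp : measurable_fun [set: R] (fun z : R => expR (c * z + m)).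
  by apply: measurableT_comp => //; apply: measurable_funD => //; exact: measurable_funM.
rewrite ge0_integral_normal_prob; last 2 first.
- by move=> z; rewrite lee_fin expR_ge0.
- exact/measurable_EFinP.
(* Completing the square: the factor [expR (c * z)] moves the mean of the Gaussian from 0 to
   [c * h]. *)
transitivity (\int[mu]_z ((expR (c ^+ 2 * h / 2 + m))%:E *
    (normal_pdf (c * h) (Num.sqrt h) z)%:E))%E.
  apply: eq_integral => z _; rewrite -!EFinM; congr EFin.
  rewrite !normal_pdfE//= mulrCA [RHS]mulrCA; congr (_ * _).
  rewrite /normal_fun -!expRD sqr_sqrtr ?(ltW h0)//; congr expR.
  by field; rewrite gt_eqF.
rewrite ge0_integralZl ?lee_fin ?expR_ge0//; last 2 first.
- by apply/measurable_EFinP; exact: measurable_normal_pdf.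
- by move=> z _; rewrite lee_fin normal_pdf_ge0.
by rewrite integral_normal_pdf mule1.
Qed.

End normal_exponential_moments.

(** * Gaussian integrals of exponential sums *)

Lemma ler_normlW2 {R : realType} (x y : R) : `|x| <= y -> - y <= x /\ x <= y.
Proof. by rewrite ler_norml => /andP. Qed.

Section exponential_sums.
Context {R : realType}.
Implicit Types (h m z : R) (s : seq (R * R)).

(** Pairs are (coefficient, rate). Polynomials in [expR z] and [expR (- z)], to which the moments of
    one step of either chain belong, have this form; their Gaussian integrals are explicit, so
    moment estimates become computations with lists. *)
Definition expsum s z : R := \sum_(p <- s) p.1 * expR (p.2 * z).

Lemma measurable_expsum s : measurable_fun [set: R] (expsum s).
Proof.
rewrite /expsum; apply: measurable_sum => p; apply: measurable_funM => //.
by apply: measurableT_comp => //; exact: measurable_funM.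
Qed.

Definition expscale c s : seq (R * R) := [seq (c * p.1, p.2) | p <- s].

Lemma expsum_scale c s z : expsum (expscale c s) z = c * expsum s z.
Proof.
by rewrite /expsum big_map big_distrr/=; apply: eq_bigr => i _; rewrite mulrA.
Qed.

Lemma expsum_cat s s' z : expsum (s ++ s') z = expsum s z + expsum s' z.
Proof. by rewrite /expsum big_cat. Qed.

Section normal.
Variable h : R.
Hypothesis h0 : 0 < h.
Local Notation nu := (normal_prob 0 (Num.sqrt h)).

Lemma integrable_normal_expR c :
  nu.-integrable setT (EFin \o (fun z => expR (c * z))).
Proof.
apply/integrableP; split.
  by apply/measurable_EFinP; apply: measurableT_comp => //; exact: measurable_funM.
under eq_integral do rewrite /= ger0_norm ?expR_ge0// -[c * _]addr0.
by rewrite integral_normal_expR// ltry.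
Qed.

Lemma integrable_normal_expsum s : nu.-integrable setT (EFin \o expsum s).
Proof.
elim: s => [|p s IH].
  rewrite (_ : EFin \o _ = cst 0%E); first exact: integrable0.
  by apply/funext => z; rewrite /= /expsum big_nil.
rewrite (_ : EFin \o _ = (fun z => p.1%:E * (EFin \o (fun z => expR (p.2 * z))) z)%E
   \+ (EFin \o expsum s)); last first.
  by apply/funext => z; rewrite /= /expsum big_cons EFinD EFinM.
by apply: integrableD => //; apply: integrableZl => //; exact: integrable_normal_expR.
Qed.

Lemma Rintegral_normal_expsum s :
  \int[nu]_z expsum s z = \sum_(p <- s) p.1 * expR (p.2 ^+ 2 * h / 2).
Proof.
elim: s => [|p s IH].
  rewrite big_nil /Rintegral; under eq_integral do rewrite /expsum big_nil.
  by rewrite integral0.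
rewrite big_cons -IH.
under eq_Rintegral do rewrite /expsum big_cons.
have i1 := integrable_normal_expR p.2.
rewrite RintegralD//; last 2 first.
- rewrite (_ : EFin \o _ = (fun z => p.1%:E * (EFin \o (fun z => expR (p.2 * z))) z)%E)//.
  exact: integrableZl.
- exact: integrable_normal_expsum.
congr (_ + _); rewrite RintegralZl//; congr (_ * _).
rewrite /Rintegral; under eq_integral do rewrite -[p.2 * _]addr0.
by rewrite integral_normal_expR// addr0.
Qed.

Lemma Rintegral_normal_expsum_scale c s :
  \int[nu]_z expsum (expscale c s) z = c * \int[nu]_z expsum s z.
Proof.
rewrite !Rintegral_normal_expsum// big_map big_distrr/=.
by apply: eq_bigr => i _; rewrite mulrA.
Qed.

Lemma Rintegral_normal_expsum_cat s s' : \int[nu]_z expsum (s ++ s') z =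
  \int[nu]_z expsum s z + \int[nu]_z expsum s' z.
Proof. by rewrite !Rintegral_normal_expsum// big_cat. Qed.

End normal.
End exponential_sums.

Section normal_step.
Context {R : realType}.
Variable h : R.
Hypothesis h0 : 0 < h.
Hypothesis h1 : h <= 1.
Local Notation nu := (normal_prob 0 (Num.sqrt h)).
Implicit Types (a m z K : R) (f p q r : R -> R) (s : seq (R * R)).

Lemma normr_RintegralB_le f p r :
  nu.-integrable setT (EFin \o f) -> nu.-integrable setT (EFin \o p) ->
  nu.-integrable setT (EFin \o r) ->
  (forall z, `|f z - p z| <= r z) ->
  `|\int[nu]_z f z - \int[nu]_z p z| <= \int[nu]_z r z.
Proof.
move=> If Ip Ir fpr; rewrite -RintegralB//.
have Ifp : nu.-integrable setT (EFin \o (fun z => f z - p z)).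
  rewrite (_ : EFin \o _ = (EFin \o f) \- (EFin \o p))%E; first exact: integrableB.
  by apply/funext => z; rewrite /= EFinB.
apply: le_trans (le_normr_Rintegral measurableT Ifp) _.
apply: le_Rintegral => //.
exact: integrable_norm.
Qed.

Lemma integrable_normal_bounded f : measurable_fun [set: R] f ->
  (forall z, 0 <= f z <= 1) -> nu.-integrable setT (EFin \o f).
Proof.
move=> mf f01; apply: measurable_bounded_integrable => //.
  by rewrite [X in (X < _)%E](probability_setT (normal_prob 0 (Num.sqrt h) : probability _ _)) ltry.
exists 1; split; first exact: num_real.
move=> M M1 z _; have /andP[f0 f1] := f01 z.
by rewrite /= ger0_norm// (le_trans f1)// ltW.
Qed.

(* The cubic Taylor remainder is split by AM-GM as
   [2 |d|^3 <= sqrt h d^2 + d^4 / sqrt h]. *)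
Lemma normal_taylor2_le a q s C2 C4 :
  0 <= a -> (forall z, 0 <= q z) -> measurable_fun [set: R] q ->
  (forall z, q z - 1 = expsum s z) ->
  forall s2, (forall z, (q z - 1) ^+ 2 = expsum s2 z) ->
  forall t2, (forall z, (q z - 1) ^+ 2 <= expsum t2 z) ->
  forall t4, (forall z, (q z - 1) ^+ 4 <= expsum t4 z) ->
  \int[nu]_z expsum t2 z <= C2 * h -> \int[nu]_z expsum t4 z <= C4 * h ^+ 2 ->
  `|\int[nu]_z expR (- (a * q z)) - expR (- a) *
     (1 - a * \int[nu]_z expsum s z + a ^+ 2 / 2 * \int[nu]_z expsum s2 z)|
  <= 108 * (C2 + C4) * (h * Num.sqrt h).
Proof.
move=> a0 q0 mq ds s2 d2s t2 dt2 t4 dt4 C2h C4h.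
have I := integrable_normal_expsum h0.
have sh0 : 0 < Num.sqrt h by rewrite sqrtr_gt0.
have sqh : Num.sqrt h * Num.sqrt h = h by rewrite -expr2 sqr_sqrtr// ltW.
pose cst0 c : seq (R * R) := [:: (c, 0)].
have cst0E c z : expsum (cst0 c) z = c.
  by rewrite /expsum big_seq1/= mul0r expR0 mulr1.
pose P := expscale (expR (- a)) (cst0 1 ++ expscale (- a) s ++ expscale (a ^+ 2 / 2) s2).
pose r := expscale 108 (expscale (Num.sqrt h) t2 ++ expscale (Num.sqrt h)^-1 t4).
have N1 : \int[nu]_z expsum (cst0 1) z = 1.
  by rewrite Rintegral_normal_expsum// big_seq1/= expr0n/= !mul0r expR0 mulr1.
have -> : expR (- a) * (1 - a * \int[nu]_z expsum s z +
    a ^+ 2 / 2 * \int[nu]_z expsum s2 z) = \int[nu]_z expsum P z.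
  by rewrite /P Rintegral_normal_expsum_scale// !Rintegral_normal_expsum_cat// !Rintegral_normal_expsum_scale// N1; ring.
have rB : \int[nu]_z expsum r z <= 108 * (C2 + C4) * (h * Num.sqrt h).
  rewrite /r Rintegral_normal_expsum_scale// Rintegral_normal_expsum_cat// !Rintegral_normal_expsum_scale// -mulrA ler_wpM2l// mulrDl lerD//.
    rewrite [leRHS](_ : _ = Num.sqrt h * (C2 * h)); last by ring.
    by rewrite ler_wpM2l// ltW.
  rewrite mulrC ler_pdivrMr// (le_trans C4h)//.
  by rewrite -!mulrA sqh.
apply: le_trans rB; apply: normr_RintegralB_le => //.
  apply: integrable_normal_bounded => [|z].
    by apply: measurableT_comp => //; apply: measurableT_comp => //; exact: measurable_funM.
  by rewrite expR_ge0 expR_le1 oppr_le0 mulr_ge0.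
move=> z; rewrite /P /r !(expsum_scale, expsum_cat) cst0E -ds -d2s.
rewrite [X in _ - X](_ : _ = expR (- a) *
  (1 - a * (q z - 1) + a ^+ 2 * (q z - 1) ^+ 2 / 2)); last by field.
apply: le_trans (normr_expRNM_taylor2_le a0 (q0 z)) _.
have -> : 216 = 108 * 2 :> R by lra.
rewrite -mulrA ler_wpM2l//.
set D := `|q z - 1|.
have D0 : 0 <= D by rewrite normr_ge0.
have D2 : D ^+ 2 <= expsum t2 z.
  by rewrite real_normK ?num_real.
have D4 : D ^+ 4 <= expsum t4 z.
  by rewrite (exprM _ 2 2) real_normK ?num_real// -exprM.
apply: (@le_trans _ _ (Num.sqrt h * D ^+ 2 + (Num.sqrt h)^-1 * D ^+ 4)); last first.
  by apply: lerD; rewrite ler_wpM2l// ltW// invr_gt0.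
have : 0 <= D ^+ 2 / Num.sqrt h * (Num.sqrt h - D) ^+ 2.
  by rewrite mulr_ge0 ?sqr_ge0// divr_ge0 ?sqr_ge0// ltW.
rewrite [X in 0 <= X](_ : _ =
  Num.sqrt h * D ^+ 2 + (Num.sqrt h)^-1 * D ^+ 4 - 2 * D ^+ 3); first by lra.
by field; rewrite gt_eqF.
Qed.

Definition expB1_sqr (c m : R) : seq (R * R) :=
  [:: (expR (2 * m), 2 * c); (- 2 * expR m, c); (1, 0)].

Definition expB1_pow4 (c m : R) : seq (R * R) :=
  [:: (expR (4 * m), 4 * c); (- 4 * expR (3 * m), 3 * c);
      (6 * expR (2 * m), 2 * c); (- 4 * expR m, c); (1, 0)].

Lemma expsum_expB1_sqr c m z :
  expsum (expB1_sqr c m) z = (expR (c * z + m) - 1) ^+ 2.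
Proof.
rewrite /expsum !big_cons big_nil/= -mulrA !expRM_natl mul0r expR0 expRD.
ring.
Qed.

Lemma expsum_expB1_pow4 c m z :
  expsum (expB1_pow4 c m) z = (expR (c * z + m) - 1) ^+ 4.
Proof.
rewrite /expsum !big_cons big_nil/= -!mulrA !expRM_natl mul0r expR0 expRD.
ring.
Qed.

(** With weights 1, -2, 1 the constant terms cancel and the first-order terms leave
    [(2 m + 2 h) - 2 (m + h / 2) = h], whence the 1; the remainders have total weight [1 + 2 = 3].
    The number [8 + 4 K] is large enough to bound, after division by [h], all exponents here and in
    the fourth power, up to [4 m + 8 h]. *)
Lemma Rintegral_expB1_sqr_le c m K : c ^+ 2 = 1 -> `|m| <= K * h ->
  \int[nu]_z expsum (expB1_sqr c m) z
  <= (1 + 3 * ((8 + 4 * K) ^+ 2 * expR (8 + 4 * K))) * h.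
Proof.
move: (h0) (h1) => hgt0 hle1 c1 mK; rewrite Rintegral_normal_expsum// !big_cons big_nil/=.
set D := 8 + 4 * K.
have K0 : 0 <= K by rewrite -(pmulr_lge0 _ h0) (le_trans _ mK).
have tay (r : R) : `|r| <= D * h -> `|expR r - 1 - r| <= D ^+ 2 * expR D * h.
  move=> rD; have rD' : `|r| <= D.
    by rewrite (le_trans rD)// ler_piMr// /D; lra.
  rewrite (le_trans (normr_expRB1Dx_le rD'))// [leRHS]mulrAC ler_wpM2r ?expR_ge0//.
  rewrite -real_normK ?num_real// (@le_trans _ _ ((D * h) ^+ 2))//.
    by rewrite lerXn2r// nnegrE// mulr_ge0 ?(ltW h0)// /D; lra.
  by rewrite exprMn ler_wpM2l ?sqr_ge0// expr2 ler_piMl// ltW.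
have e2 : expR (2 * m) * expR ((2 * c) ^+ 2 * h / 2) = expR (2 * m + 2 * h).
  by rewrite -expRD exprMn c1; congr expR; field.
have e1 : expR m * expR (c ^+ 2 * h / 2) = expR (m + h / 2).
  by rewrite -expRD c1 mul1r.
have e0 : expR (0 ^+ 2 * h / 2) = 1 by rewrite expr0n/= !mul0r expR0.
rewrite -!(mulrA _ (expR _) (expR _)) e2 e1 e0.
have [mK1 mK2] := ler_normlW2 mK.
have Kh : 0 <= K * h by rewrite mulr_ge0// ltW.
have t2 : `|expR (2 * m + 2 * h) - 1 - (2 * m + 2 * h)| <= D ^+ 2 * expR D * h.
  by apply: tay; rewrite ler_norml /D; apply/andP; split; lra.
have t1 : `|expR (m + h / 2) - 1 - (m + h / 2)| <= D ^+ 2 * expR D * h.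
  by apply: tay; rewrite ler_norml /D; apply/andP; split; lra.
have [? ?] := ler_normlW2 t2; have [? ?] := ler_normlW2 t1; lra.
Qed.

(** With weights 1, -4, 6, -4, 1 the first-order terms cancel as well: [(4 m + 8 h) - 4 (3 m + 9 h /
    2) + 6 (2 m + 2 h) - 4 (m + h / 2) = 0]. Only remainders of order [h ^ 2] survive, of total
    weight [1 + 4 + 6 + 4 = 15]. *)
Lemma Rintegral_expB1_pow4_le c m K : c ^+ 2 = 1 -> `|m| <= K * h ->
  \int[nu]_z expsum (expB1_pow4 c m) z
  <= 15 * ((8 + 4 * K) ^+ 2 * expR (8 + 4 * K)) * h ^+ 2.
Proof.
move: (h0) (h1) => hgt0 hle1 c1 mK; rewrite Rintegral_normal_expsum// !big_cons big_nil/=.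
set D := 8 + 4 * K.
have K0 : 0 <= K by rewrite -(pmulr_lge0 _ h0) (le_trans _ mK).
have tay (r : R) : `|r| <= D * h -> `|expR r - 1 - r| <= D ^+ 2 * expR D * h ^+ 2.
  move=> rD; have rD' : `|r| <= D.
    by rewrite (le_trans rD)// ler_piMr// /D; lra.
  rewrite (le_trans (normr_expRB1Dx_le rD'))// [leRHS]mulrAC ler_wpM2r ?expR_ge0//.
  rewrite -real_normK ?num_real// -exprMn.
  by rewrite lerXn2r// nnegrE// mulr_ge0 ?(ltW h0)// /D; lra.
have e4 : expR (4 * m) * expR ((4 * c) ^+ 2 * h / 2) = expR (4 * m + 8 * h).
  by rewrite -expRD exprMn c1; congr expR; field.
have e3 : expR (3 * m) * expR ((3 * c) ^+ 2 * h / 2) = expR (3 * m + 9 / 2 * h).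
  by rewrite -expRD exprMn c1; congr expR; field.
have e2 : expR (2 * m) * expR ((2 * c) ^+ 2 * h / 2) = expR (2 * m + 2 * h).
  by rewrite -expRD exprMn c1; congr expR; field.
have e1 : expR m * expR (c ^+ 2 * h / 2) = expR (m + h / 2).
  by rewrite -expRD c1 mul1r.
have e0 : expR (0 ^+ 2 * h / 2) = 1 by rewrite expr0n/= !mul0r expR0.
rewrite -!(mulrA _ (expR _) (expR _)) e4 e3 e2 e1 e0.
have [mK1 mK2] := ler_normlW2 mK.
have Kh : 0 <= K * h by rewrite mulr_ge0// ltW.
have t4 : `|expR (4 * m + 8 * h) - 1 - (4 * m + 8 * h)| <= D ^+ 2 * expR D * h ^+ 2.
  by apply: tay; rewrite ler_norml /D; apply/andP; split; lra.
have t3 : `|expR (3 * m + 9 / 2 * h) - 1 - (3 * m + 9 / 2 * h)| <= D ^+ 2 * expR D * h ^+ 2.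
  by apply: tay; rewrite ler_norml /D; apply/andP; split; lra.
have t2 : `|expR (2 * m + 2 * h) - 1 - (2 * m + 2 * h)| <= D ^+ 2 * expR D * h ^+ 2.
  by apply: tay; rewrite ler_norml /D; apply/andP; split; lra.
have t1 : `|expR (m + h / 2) - 1 - (m + h / 2)| <= D ^+ 2 * expR D * h ^+ 2.
  by apply: tay; rewrite ler_norml /D; apply/andP; split; lra.
have [? ?] := ler_normlW2 t4; have [? ?] := ler_normlW2 t3.
by have [? ?] := ler_normlW2 t2; have [? ?] := ler_normlW2 t1; lra.
Qed.

End normal_step.

(** * One-step duality estimate *)

Section hyperbolic.
Context {R : realType}.
Implicit Types x y : R.

Lemma coshRN x : coshR (- x) = coshR x.
Proof. by rewrite /coshR opprK addrC. Qed.

Lemma coshR_norm x : coshR `|x| = coshR x.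
Proof.
by have [x0|x0] := leP 0 x; [rewrite ger0_norm|rewrite ltr0_norm// coshRN].
Qed.

Lemma ler_coshR x y : 0 <= x -> x <= y -> coshR x <= coshR y.
Proof.
move=> x0 xy; rewrite /coshR ler_wpM2r//.
have h1 : expR x <= expR y by rewrite ler_expR.
have h2 : expR x * expR (- x) = 1 by exact: expRxMexpNx_1.
have h3 : expR y * expR (- y) = 1 by exact: expRxMexpNx_1.
have h4 : 1 <= expR x by rewrite -expR0 ler_expR.
have h5 := expR_gt0 (- y); have h6 := expR_gt0 (- x).
have h7 : expR (- x) <= 1 by nra.
have h8 : expR (- y) <= 1 by nra.
have : expR (- x) - expR (- y) = expR (- x) * expR (- y) * (expR y - expR x).
  by rewrite mulrBr -!mulrA [expR (- y) * _]mulrC h3 mulr1 [expR (- y) * _]mulrC mulrA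
    [expR (- x) * _]mulrC h2 mul1r.
have h9 : expR (- x) * expR (- y) <= 1 by nra.
nra.
Qed.

Lemma coshR_ge1 x : 1 <= coshR x.
Proof.
by rewrite -coshR_norm (le_trans _ (ler_coshR (lexx 0) (normr_ge0 x)))//
  /coshR oppr0 expR0; lra.
Qed.

Lemma coshR_gt1 x : 0 < x -> 1 < coshR x.
Proof.
move=> x0; rewrite /coshR.
have h2 : expR x * expR (- x) = 1 by exact: expRxMexpNx_1.
have h4 : 1 < expR x by rewrite -expR0 ltr_expR.
have h6 := expR_gt0 (- x).
nra.
Qed.

End hyperbolic.

Section kernel_estimates.
Context {R : realType}.
Implicit Types a b h k x y z : R.

(** The shift [- h / 2] gives the lognormal factor mean exactly 1, so there is no first-order term,
    and variance [expR h - 1]. The constant is that of [normal_taylor2_le] with the moment bounds at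
    [K = 1/2], where [8 + 4 K = 10]. *)
Lemma Gamma_kernel_taylor_le h a : 0 < h -> h <= 1 -> 0 <= a ->
  `|\int[normal_prob 0 (Num.sqrt h)]_z expR (- (a * expR (z - h / 2))) -
    expR (- a) * (1 + a ^+ 2 / 2 * (expR h - 1))|
  <= 108 * (1 + 18 * (100 * expR 10)) * (h * Num.sqrt h).
Proof.
move=> h0 h1 a0.
pose s : seq (R * R) := [:: (expR (- (h / 2)), 1); (- 1, 0)].
have sE z : expR (z - h / 2) - 1 = expsum s z.
  rewrite /expsum !big_cons big_nil/= mul1r mul0r expR0 expRD; ring.
have s2E z : (expR (z - h / 2) - 1) ^+ 2 = expsum (expB1_sqr 1 (- (h / 2))) z.
  by rewrite expsum_expB1_sqr mul1r.
have s4E z : (expR (z - h / 2) - 1) ^+ 4 = expsum (expB1_pow4 1 (- (h / 2))) z.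
  by rewrite expsum_expB1_pow4 mul1r.
have s2L z : (expR (z - h / 2) - 1) ^+ 2 <= expsum (expB1_sqr 1 (- (h / 2))) z.
  by rewrite s2E.
have s4L z : (expR (z - h / 2) - 1) ^+ 4 <= expsum (expB1_pow4 1 (- (h / 2))) z.
  by rewrite s4E.
have e10 : 8 + 4 * (1 / 2) = 10 :> R by lra.
have e100 : 10 ^+ 2 = 100 :> R by ring.
have mE : `|- (h / 2)| <= 1 / 2 * h by rewrite normrN ger0_norm; lra.
have -> : 1 + 18 * (100 * expR 10) = (1 + 3 * (100 * expR 10)) + 15 * (100 * expR 10) :> R.
  by ring.
have N1 : \int[normal_prob 0 (Num.sqrt h)]_z expsum s z = 0.
  rewrite Rintegral_normal_expsum// !big_cons big_nil/= expr1n expr0n/= !mul1r !mul0r.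
  by rewrite expR0 -expRD addNr expR0; ring.
have N2 : \int[normal_prob 0 (Num.sqrt h)]_z expsum (expB1_sqr 1 (- (h / 2))) z =
    expR h - 1.
  rewrite Rintegral_normal_expsum// !big_cons big_nil/= expr0n/= !mul0r expR0.
  rewrite -!(mulrA _ (expR _) (expR _)) -!expRD.
  have -> : 2 * - (h / 2) + (2 * 1) ^+ 2 * h / 2 = h by field.
  have -> : - (h / 2) + 1 ^+ 2 * h / 2 = 0 by field.
  by rewrite expR0; ring.
have := @normal_taylor2_le R h h0 a (fun z => expR (z - h / 2)) s
  (1 + 3 * (100 * expR 10)) (15 * (100 * expR 10)) a0 _ _ sE _ s2E _ s2L _ s4L.
rewrite N1 mulr0 subr0 N2; apply.
- by move=> z; rewrite expR_ge0.
- by apply: measurableT_comp => //; exact: measurable_funB.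
- have := @Rintegral_expB1_sqr_le R h h0 h1 1 _ _ (expr1n _ _) mE.
  by rewrite N2 e10 e100.
- have := @Rintegral_expB1_pow4_le R h h0 h1 1 _ _ (expr1n _ _) mE.
  by rewrite e10 e100.
Qed.

(** The quotient compares [cosh - 1] after and before an Euler step. Its mean is [1 + O(h ^ 2)],
    since the drift compensates the convexity of [cosh], and its second moment about 1 is, to the
    same order, [h sinh ^ 2 x / (cosh x - 1) ^ 2 = h (1 + 2 / (cosh x - 1))]. [K] controls all
    occurrences of [cosh x - 1] as a denominator. *)
Lemma hyperbolic_kernel_taylor_le h a x K :
  0 < h -> h <= 1 -> 0 <= a -> 0 < x ->
  coshR x / (coshR x - 1) <= K ->
  `|\int[normal_prob 0 (Num.sqrt h)]_z
      expR (- (a * ((coshR (x + z - cothR x / 2 * h) - 1) / (coshR x - 1)))) -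
    expR (- a) * (1 + a ^+ 2 / 2 * (h * (1 + 2 / (coshR x - 1))))|
  <= (108 * (6 * K ^+ 2 + 64 * K ^+ 4) + K + 6 * K ^+ 2) *
     (1 + (8 + 4 * K) ^+ 2 * expR (8 + 4 * K)) * (h * Num.sqrt h).
Proof.
move=> h0 h1 a0 x0.
set c := coshR x; set s := sinhR x; set k := (c - 1)^-1.
pose X := expR x; pose Y := expR (- x).
have XY : X * Y = 1 by exact: expRxMexpNx_1.
have X0 : 0 < X by exact: expR_gt0.
have Y0 : 0 < Y by exact: expR_gt0.
have X1 : 1 < X by rewrite /X -expR0 ltr_expR.
have Y1 : Y < 1 by nra.
have cE : c = (X + Y) / 2 by [].
have sE : s = (X - Y) / 2 by [].
have c1 : 1 < c by exact: coshR_gt1.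
have k0 : 0 < k by rewrite invr_gt0 subr_gt0.
have s0 : 0 < s by rewrite sE; lra.
have kc1 : k * (c - 1) = 1 by rewrite mulVf// gt_eqF// subr_gt0.
move=> cK; set b := - cothR x / 2.
have bs : b * s = - c / 2.
  by rewrite /b /cothR -/c -/s; field; rewrite gt_eqF.
have bK : `|b| <= K.
  have cs : c - 1 <= s by rewrite cE sE; lra.
  have cs0 : 0 <= c / s by rewrite divr_ge0 ?ltW//; lra.
  have csk : c / s <= c / (c - 1).
    rewrite ler_wpM2l//; first by lra.
    by rewrite lef_pV2// posrE subr_gt0.
  have csK : c / s <= K := le_trans csk cK.
  by rewrite /b /cothR -/c -/s mulNr normrN ger0_norm; lra.
have K0 : 0 <= K by apply: le_trans bK.
have ck : c * k <= K by exact: cK.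
set m := b * h.
have mK : `|m| <= K * h by rewrite normrM (ger0_norm (ltW h0)) ler_wpM2r// ltW.
set D := 8 + 4 * K; set E := D ^+ 2 * expR D.
have D0 : 0 <= D by rewrite /D; lra.
have E0 : 0 <= E by rewrite mulr_ge0 ?sqr_ge0 ?expR_ge0.
have hsh : h <= Num.sqrt h.
  rewrite -{1}(sqr_sqrtr (ltW h0)) expr2 ler_piMr ?sqrtr_ge0//.
  by rewrite -sqrtr1 ler_sqrt.
have hh : h ^+ 2 <= h * Num.sqrt h by rewrite expr2 ler_wpM2l// ltW.
have tay (r : R) : `|r| <= D * h -> `|expR r - 1 - r| <= E * h ^+ 2.
  move=> rD; have rD' : `|r| <= D by rewrite (le_trans rD)// ler_piMr.
  rewrite (le_trans (normr_expRB1Dx_le rD'))// /E [leRHS]mulrAC ler_wpM2r ?expR_ge0//.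
  rewrite -real_normK ?num_real// -exprMn.
  by rewrite lerXn2r// nnegrE// mulr_ge0 ?(ltW h0).
pose q z := (coshR (x + z - cothR x / 2 * h) - 1) / (c - 1).
have chE z : coshR (x + z - cothR x / 2 * h) =
    (X * expR (z + m) + Y * expR (- 1 * z + - m)) / 2.
  rewrite /coshR /X /Y -!expRD /m /b.
  by congr ((expR _ + expR _) / _); ring.
pose S : seq (R * R) := expscale k
  [:: (X / 2 * expR m, 1); (Y / 2 * expR (- m), - 1); (- c, 0)].
pose S2 : seq (R * R) := expscale (k ^+ 2)
  [:: (X ^+ 2 / 4 * expR (2 * m), 2); (Y ^+ 2 / 4 * expR (2 * - m), - 2);
      (1 / 2 + c ^+ 2, 0); (- c * X * expR m, 1); (- c * Y * expR (- m), - 1)].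
pose T2 := expscale (K ^+ 2) (expB1_sqr 1 m ++ expB1_sqr (- 1) (- m)).
pose T4 := expscale (2 * K ^+ 4) (expB1_pow4 1 m ++ expB1_pow4 (- 1) (- m)).
have qd z : q z - 1 = k * (coshR (x + z - cothR x / 2 * h) - c).
  rewrite /q -/k; have : k * (c - 1) = 1 by []. lra.
have qS z : q z - 1 = expsum S z.
  rewrite qd chE expsum_scale /expsum !big_cons big_nil/= !(mul0r, mul1r) expR0 !expRD.
  ring.
have qS2 z : (q z - 1) ^+ 2 = expsum S2 z.
  rewrite qd chE expsum_scale /expsum !big_cons big_nil/= !(mul0r, mul1r) expR0 !expRD.
  rewrite exprMn; congr (_ * _).
  have -> : expR (- 2 * z) = (expR z ^+ 2)^-1 by rewrite mulNr expRN expRM_natl.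
  rewrite !expRM_natl.
  have -> : expR (- 1 * z) = (expR z)^-1 by rewrite mulN1r expRN.
  have -> : expR (- m) = (expR m)^-1 by rewrite expRN.
  have ez := expR_gt0 z; have em := expR_gt0 m.
  have YX : Y = X^-1 by rewrite /Y expRN.
  by rewrite cE YX; field; rewrite !gt_eqF.
(* Cauchy-Schwarz: [q z - 1] has the form [u P + v Q] with nonnegative [u], [v] such that
   [u + v = k c <= K], whence [u ^ 2 + v ^ 2 <= K ^ 2]. *)
have kq u v P Q : u = k * (X / 2) -> v = k * (Y / 2) ->
    (u * P + v * Q) ^+ 2 <= K ^+ 2 * (P ^+ 2 + Q ^+ 2).
  move=> -> ->; set u' := k * (X / 2); set v' := k * (Y / 2).
  have uv : u' + v' <= K by rewrite /u' /v'; move: ck; rewrite cE; lra.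
  have u0 : 0 <= u' by rewrite mulr_ge0// ?ltW// divr_gt0.
  have v0 : 0 <= v' by rewrite mulr_ge0// ?ltW// divr_gt0.
  have uv2 : u' ^+ 2 + v' ^+ 2 <= K ^+ 2 by nra.
  have cs : (u' * P + v' * Q) ^+ 2 <= (u' ^+ 2 + v' ^+ 2) * (P ^+ 2 + Q ^+ 2).
    by have := sqr_ge0 (u' * Q - v' * P); lra.
  by rewrite (le_trans cs)// ler_wpM2r// addr_ge0 ?sqr_ge0.
have qPQ z : (q z - 1) ^+ 2 <=
    K ^+ 2 * ((expR (1 * z + m) - 1) ^+ 2 + (expR (- 1 * z + - m) - 1) ^+ 2).
  apply: le_trans (kq _ _ _ _ erefl erefl).
  by rewrite qd chE cE mul1r le_eqVlt; apply/orP; left; apply/eqP; ring.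
have qT2 z : (q z - 1) ^+ 2 <= expsum T2 z.
  by rewrite expsum_scale expsum_cat !expsum_expB1_sqr.
have qT4 z : (q z - 1) ^+ 4 <= expsum T4 z.
  rewrite expsum_scale expsum_cat !expsum_expB1_pow4 (exprM _ 2 2).
  set P := expR _ - 1 in qPQ *; set Q := expR _ - 1 in qPQ *.
  have : ((q z - 1) ^+ 2) ^+ 2 <= (K ^+ 2 * (P ^+ 2 + Q ^+ 2)) ^+ 2.
    by rewrite lerXn2r// ?nnegrE ?sqr_ge0// mulr_ge0 ?addr_ge0 ?sqr_ge0.
  move=> /le_trans; apply.
  rewrite exprMn -exprM [leRHS]mulrAC [leRHS]mulrC ler_wpM2l ?exprn_ge0//.
  by have := sqr_ge0 (P ^+ 2 - Q ^+ 2); lra.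
have q0 z : 0 <= q z.
  by rewrite divr_ge0// subr_ge0 ?coshR_ge1// ltW.
have mq : measurable_fun [set: R] q.
  rewrite (_ : q = (fun z => 1 + expsum S z)); last first.
    by apply/funext => z; rewrite -qS; ring.
  by apply: measurable_funD => //; exact: measurable_expsum.
have n1 : (- 1) ^+ 2 = 1 :> R by rewrite sqrrN expr1n.
have mKN : `|- m| <= K * h by rewrite normrN.
have NT2 : \int[normal_prob 0 (Num.sqrt h)]_z expsum T2 z <=
    (2 * K ^+ 2 * (1 + 3 * E)) * h.
  rewrite Rintegral_normal_expsum_scale// Rintegral_normal_expsum_cat//.
  rewrite [leRHS](_ : _ = K ^+ 2 * ((1 + 3 * E) * h + (1 + 3 * E) * h)); last by ring.
  rewrite ler_wpM2l ?sqr_ge0// lerD//; first exact: Rintegral_expB1_sqr_le (expr1n _ _) mK.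
  exact: Rintegral_expB1_sqr_le n1 mKN.
have NT4 : \int[normal_prob 0 (Num.sqrt h)]_z expsum T4 z <=
    (2 * K ^+ 4 * (30 * E)) * h ^+ 2.
  rewrite Rintegral_normal_expsum_scale// Rintegral_normal_expsum_cat//.
  rewrite [leRHS](_ : _ = (2 * K ^+ 4) * (15 * E * h ^+ 2 + 15 * E * h ^+ 2)); last by ring.
  rewrite ler_wpM2l ?mulr_ge0 ?exprn_ge0// lerD//; first exact: Rintegral_expB1_pow4_le (expr1n _ _) mK.
  exact: Rintegral_expB1_pow4_le n1 mKN.
have main := normal_taylor2_le h0 a0 q0 mq qS qS2 qT2 qT4 NT2 NT4.
have [mK1 mK2] := ler_normlW2 mK.
have Kh : 0 <= K * h by rewrite mulr_ge0// ltW.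
have o1 : `|expR (m + h / 2) - 1 - (m + h / 2)| <= E * h ^+ 2.
  by apply: tay; rewrite ler_norml /D; apply/andP; split;
    clear -h0 mK1 mK2 Kh; lra.
have o2 : `|expR (- m + h / 2) - 1 - (- m + h / 2)| <= E * h ^+ 2.
  by apply: tay; rewrite ler_norml /D; apply/andP; split;
    clear -h0 mK1 mK2 Kh; lra.
have o3 : `|expR (2 * m + 2 * h) - 1 - (2 * m + 2 * h)| <= E * h ^+ 2.
  by apply: tay; rewrite ler_norml /D; apply/andP; split;
    clear -h0 mK1 mK2 Kh; lra.
have o4 : `|expR (2 * - m + 2 * h) - 1 - (2 * - m + 2 * h)| <= E * h ^+ 2.
  by apply: tay; rewrite ler_norml /D; apply/andP; split;
    clear -h0 mK1 mK2 Kh; lra.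
set r1 := expR (m + h / 2) in o1; set r2 := expR (- m + h / 2) in o2.
set r3 := expR (2 * m + 2 * h) in o3; set r4 := expR (2 * - m + 2 * h) in o4.
have f1 : r1 = expR m * expR (h / 2) by rewrite -expRD.
have f2 : r2 = expR (- m) * expR (h / 2) by rewrite -expRD.
have f3 : r3 = expR (2 * m) * expR (2 * h) by rewrite -expRD.
have f4 : r4 = expR (2 * - m) * expR (2 * h) by rewrite -expRD.
have x0h : 0 ^+ 2 * h / 2 = 0 by rewrite expr0n/= !mul0r.
have x1h : 1 ^+ 2 * h / 2 = h / 2 by rewrite expr1n mul1r.
have x2h : 2 ^+ 2 * h / 2 = 2 * h by field.
have N1 : \int[normal_prob 0 (Num.sqrt h)]_z expsum S z =
    k * ((X * r1 + Y * r2) / 2 - c).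
  rewrite Rintegral_normal_expsum_scale// Rintegral_normal_expsum// !big_cons big_nil/=.
  by rewrite sqrrN x0h x1h expR0 f1 f2; field.
have N2 : \int[normal_prob 0 (Num.sqrt h)]_z expsum S2 z = k ^+ 2 *
    ((X ^+ 2 * r3 + Y ^+ 2 * r4) / 4 + 1 / 2 + c ^+ 2 - c * (X * r1 + Y * r2)).
  rewrite Rintegral_normal_expsum_scale// Rintegral_normal_expsum// !big_cons big_nil/=.
  by rewrite !sqrrN x0h x1h x2h expR0 f1 f2 f3 f4; field.
set th1 := (X * (r1 - 1 - (m + h / 2)) + Y * (r2 - 1 - (- m + h / 2))) / 2.
set th2 := (X ^+ 2 * (r3 - 1 - (2 * m + 2 * h)) +
            Y ^+ 2 * (r4 - 1 - (2 * - m + 2 * h))) / 4.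
(* The drift is designed for this: [2 m sinh x = - h cosh x] cancels the first-order term of the
   mean, which is left with the Taylor remainder [th1] alone. *)
have mXY : m * (X - Y) = - h * (X + Y) / 2.
  have -> : X - Y = 2 * s by rewrite sE; field.
  have -> : m * (2 * s) = 2 * h * (b * s) by rewrite /m; ring.
  by rewrite bs cE; field.
have N1' : \int[normal_prob 0 (Num.sqrt h)]_z expsum S z = k * th1.
  rewrite N1; congr (_ * _); rewrite /th1 cE.
  by clear -mXY; lra.
have N2' : \int[normal_prob 0 (Num.sqrt h)]_z expsum S2 z =
    h * (1 + 2 * k) + k ^+ 2 * (th2 - 2 * c * th1).
  have -> : h * (1 + 2 * k) = k ^+ 2 * (h * ((c - 1) * (c + 1))).
    have -> : k ^+ 2 * (h * ((c - 1) * (c + 1))) =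
      (k * (c - 1)) * (h * ((k * (c - 1)) + 2 * k)) by ring.
    by rewrite kc1 mul1r.
  rewrite N2 -mulrDr; congr (_ * _).
  have YX : Y = X^-1 by rewrite /Y expRN.
  have key : m * (X ^+ 2 - Y ^+ 2) = - h * (X + Y) ^+ 2 / 2.
    have -> : m * (X ^+ 2 - Y ^+ 2) = (m * (X - Y)) * (X + Y) by ring.
    by rewrite mXY; field.
  rewrite /th1 /th2 cE.
  have XYh : h * (X * Y) = h by rewrite XY mulr1.
  have XYm : (X + Y) * (m * (X - Y)) = (X + Y) * (- h * (X + Y) / 2) by rewrite mXY.
  by clear -XYh XYm key XY mXY; lra.
have B1 : `|th1| <= c * (E * h ^+ 2).
  have -> : c * (E * h ^+ 2) = (X * (E * h ^+ 2) + Y * (E * h ^+ 2)) / 2.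
    by rewrite cE; field.
  rewrite /th1 normrM [X in _ * X]gtr0_norm// ler_wpM2r//.
  apply: (le_trans (ler_normD _ _)); apply: lerD.
    by rewrite normrM gtr0_norm// ler_wpM2l// ltW.
  by rewrite normrM gtr0_norm// ler_wpM2l// ltW.
have B2 : `|th2| <= c ^+ 2 * (E * h ^+ 2).
  have -> : c ^+ 2 * (E * h ^+ 2) = (X + Y) ^+ 2 * (E * h ^+ 2) / 4.
    by rewrite cE; field.
  rewrite /th2 normrM [X in _ * X]gtr0_norm// ler_wpM2r//.
  apply: (@le_trans _ _ (X ^+ 2 * (E * h ^+ 2) + Y ^+ 2 * (E * h ^+ 2))).
    apply: (le_trans (ler_normD _ _)); apply: lerD.
      by rewrite normrM ger0_norm ?sqr_ge0// ler_wpM2l// sqr_ge0.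
    by rewrite normrM ger0_norm ?sqr_ge0// ler_wpM2l// sqr_ge0.
  rewrite -mulrDl ler_wpM2r//; first exact: mulr_ge0 E0 (sqr_ge0 h).
  by have := mulr_gt0 X0 Y0; clear; lra.
have v0 := expR_gt0 (- a).
have w1 : a * expR (- a) <= 1 := exprn_mul_expRN_le 1 a0.
have w2 : a ^+ 2 * expR (- a) <= 4 := exprn_mul_expRN_le 2 a0.
have c0 : 0 <= c := ltW (lt_trans ltr01 c1).
have ck0 : 0 <= c * k := mulr_ge0 c0 (ltW k0).
set rho := E * h ^+ 2 in B1 B2.
have rho0 : 0 <= rho := mulr_ge0 E0 (sqr_ge0 h).
have Bk1 : `|k * th1| <= K * rho.
  rewrite normrM gtr0_norm//.
  apply: (@le_trans _ _ (c * k * rho)); last by rewrite ler_wpM2r.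
  by rewrite -mulrA mulrCA ler_wpM2l// ltW.
have Bk2 : `|k ^+ 2 * (th2 - 2 * c * th1)| <= 3 * K ^+ 2 * rho.
  have B3 : `|th2 - 2 * c * th1| <= 3 * c ^+ 2 * rho.
    rewrite (le_trans (ler_normB _ _))// (normrM (2 * c)) (@ger0_norm _ (2 * c)) ?mulr_ge0//.
    have : 2 * c * `|th1| <= 2 * c * (c * rho) by rewrite ler_wpM2l// mulr_ge0.
    by clear -B2; lra.
  rewrite normrM (@ger0_norm _ (k ^+ 2)) ?sqr_ge0//.
  apply: (@le_trans _ _ (k ^+ 2 * (3 * c ^+ 2 * rho))); first by rewrite ler_wpM2l// sqr_ge0.
  have -> : k ^+ 2 * (3 * c ^+ 2 * rho) = 3 * (c * k) ^+ 2 * rho by ring.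
  by rewrite ler_wpM2r// ler_wpM2l// lerXn2r.
(* The weights [a expR (- a) <= 1] and [a ^ 2 expR (- a) / 2 <= 2] turn the moment errors [K rho]
   and [3 K ^ 2 rho] into the factor [K + 6 K ^ 2]. *)
have fin : `|expR (- a) * (1 - a * \int[normal_prob 0 (Num.sqrt h)]_z expsum S z
     + a ^+ 2 / 2 * \int[normal_prob 0 (Num.sqrt h)]_z expsum S2 z) -
    expR (- a) * (1 + a ^+ 2 / 2 * (h * (1 + 2 * k)))| <= (K + 6 * K ^+ 2) * rho.
  rewrite N1' N2'.
  set g1 := k * th1 in Bk1 *; set g2 := k ^+ 2 * _ in Bk2 *.
  rewrite [X in `|X|](_ : _ = (a ^+ 2 * expR (- a)) / 2 * g2 - a * expR (- a) * g1);
    last by field.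
  have w1p : 0 <= a * expR (- a) by rewrite mulr_ge0// ltW.
  have w2p : 0 <= a ^+ 2 * expR (- a) / 2.
    by rewrite divr_ge0// mulr_ge0 ?sqr_ge0// ltW.
  apply: (le_trans (ler_normB _ _)); rewrite mulrDl addrC; apply: lerD.
    rewrite (normrM (a * _)) (ger0_norm w1p) -[leRHS]mul1r.
    by apply: ler_pM.
  rewrite (normrM (_ / 2)) (ger0_norm w2p).
  rewrite [leRHS](_ : _ = 2 * (3 * K ^+ 2 * rho)); last by ring.
  by apply: ler_pM => //; clear -w2; lra.
rewrite -[2 / _]/(2 * k).
set I := \int[_]_z _; set J := expR (- a) * _.
rewrite -/I in main.
set M := expR (- a) * _ in main fin.
apply: (@le_trans _ _ (`|I - M| + `|M - J|)).
  exact: ler_distD.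
apply: (@le_trans _ _ (108 * (2 * K ^+ 2 * (1 + 3 * E) + 2 * K ^+ 4 * (30 * E)) *
   (h * Num.sqrt h) + (K + 6 * K ^+ 2) * (E * (h * Num.sqrt h)))).
  apply: lerD => //; apply: le_trans fin _.
  by rewrite ler_wpM2l ?addr_ge0 ?mulr_ge0 ?sqr_ge0// ler_wpM2l.
set H := h * Num.sqrt h.
have H0 : 0 <= H by rewrite mulr_ge0 ?sqrtr_ge0// ltW.
rewrite [X in X <= _](_ : _ = (108 * (2 * K ^+ 2 * (1 + 3 * E) + 2 * K ^+ 4 * (30 * E))
  + (K + 6 * K ^+ 2) * E) * H); last by ring.
rewrite ler_wpM2r//.
have K2 : 0 <= K ^+ 2 by exact: sqr_ge0.
have K4 : 0 <= K ^+ 4 by exact: exprn_ge0.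
have E2 : 0 <= K ^+ 2 * E by exact: mulr_ge0.
have E4 : 0 <= K ^+ 4 * E by exact: mulr_ge0.
have KE : 0 <= K * E by exact: mulr_ge0.
by clear -K0 K2 K4 E2 E4 KE E0; lra.
Qed.

End kernel_estimates.

Section duality_kernel.
Context {R : realType}.

(** The first kernel is expanded at [a = g beta (cosh x - 1)], the second at the value [v] reached
    from [a] by the harmonic flow, and the flow lemma compares the two expansions. In the variance
    factor [1 + 2 / (cosh x - 1)] of the first, the 1 is matched by the lognormal variance and the
    quotient by the flow. [C] depends on [eps] through [k0]. *)
Lemma duality_kernel_le (eps beta : R) : 0 < eps -> 0 < beta ->
  exists2 C : R, 0 <= C & forall h x g, 0 < h -> h <= 1 -> eps <= x -> 0 <= g ->
  `|\int[normal_prob 0 (Num.sqrt h)]_z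
      expR (- (g * (beta * (coshR (x + z - cothR x / 2 * h) - 1)))) -
    \int[normal_prob 0 (Num.sqrt h)]_z
      expR (- (beta * (coshR x - 1) *
               (g * expR (z - h / 2) / (1 + beta * h * g))))|
  <= C * (h * Num.sqrt h).
Proof.
move=> e0 b0; set c0 := coshR eps.
have c01 : 1 < c0 by exact: coshR_gt1.
set k0 := (c0 - 1)^-1.
have k00 : 0 < k0 by rewrite invr_gt0 subr_gt0.
set K := 1 + k0.
have K0 : 0 <= K by rewrite /K; lra.
set C1 := (108 * (6 * K ^+ 2 + 64 * K ^+ 4) + K + 6 * K ^+ 2) *
     (1 + (8 + 4 * K) ^+ 2 * expR (8 + 4 * K)).
set C2 := 108 * (1 + 18 * (100 * expR 10)) : R.
set C3 := 310 * k0 ^+ 2 + 2 * expR 1 + 155 * k0.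
have C30 : 0 <= C3.
  by rewrite /C3; have := sqr_ge0 k0; have := expR_gt0 (1 : R); clear -k00; lra.
have C20 : 0 <= C2 by rewrite /C2; have := expR_gt0 (10 : R); clear; lra.
exists (C1 + C3 + C2).
  apply: addr_ge0 C20; apply: addr_ge0 C30; apply: mulr_ge0; last by rewrite addr_ge0// mulr_ge0 ?sqr_ge0 ?expR_ge0.
  by have := exprn_ge0 2 K0; have := exprn_ge0 4 K0; clear -K0; lra.
move=> h x g h0 h1 ex g0.
have x0 : 0 < x by exact: lt_le_trans ex.
set c := coshR x.
have c0c : c0 <= c by apply: ler_coshR => //; exact: ltW.
have c1 : 1 < c by exact: lt_le_trans c0c.
set k := (c - 1)^-1.
have k_gt0 : 0 < k by rewrite invr_gt0 subr_gt0.
have kk0 : k <= k0 by rewrite lef_pV2 ?posrE ?subr_gt0// lerD2r.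
have ckK : c / (c - 1) <= K.
  have -> : c / (c - 1) = 1 + k by rewrite /k; field; rewrite gt_eqF// subr_gt0.
  by rewrite /K lerD2l.
set a := g * (beta * (c - 1)).
have a0 : 0 <= a by rewrite !mulr_ge0// ?subr_ge0 ltW.
have den : 0 < 1 + beta * h * g by rewrite ltr_pwDl// !mulr_ge0// ltW.
(* This turns the denominator [1 + beta * h * g] of the [Gamma] chain into the denominator
   [1 + h * k * a] of the flow. *)
have ka : k * a = beta * g by rewrite /k /a; field; rewrite gt_eqF// subr_gt0.
set v := a / (1 + h * k * a).
have vE : v = a / (1 + beta * h * g).
  by rewrite /v -mulrA ka (_ : h * (beta * g) = beta * h * g)//; ring.
have v0 : 0 <= v by rewrite vE divr_ge0// ltW.
have A := hyperbolic_kernel_taylor_le h0 h1 a0 x0 ckK.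
have B := Gamma_kernel_taylor_le h0 h1 v0.
have k01 : 0 <= h <= 1 by rewrite (ltW h0).
have H := expRN_harmonic_taylor_le a0 (ltW k_gt0) k01 (erefl v).
have -> : \int[normal_prob 0 (Num.sqrt h)]_z
      expR (- (g * (beta * (coshR (x + z - cothR x / 2 * h) - 1)))) =
    \int[normal_prob 0 (Num.sqrt h)]_z
      expR (- (a * ((coshR (x + z - cothR x / 2 * h) - 1) / (coshR x - 1)))).
  apply: eq_Rintegral => z _; congr expR; congr (- _).
  by rewrite -/c /a; field; rewrite gt_eqF// subr_gt0.
have -> : \int[normal_prob 0 (Num.sqrt h)]_z expR (- (beta * (c - 1) *
               (g * expR (z - h / 2) / (1 + beta * h * g)))) =
    \int[normal_prob 0 (Num.sqrt h)]_z expR (- (v * expR (z - h / 2))).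
  apply: eq_Rintegral => z _; congr expR; congr (- _).
  by rewrite vE /a; field; rewrite gt_eqF.
have hsh : h <= Num.sqrt h.
  rewrite -{1}(sqr_sqrtr (ltW h0)) expr2 ler_piMr ?sqrtr_ge0//.
  by rewrite -sqrtr1 ler_sqrt.
have hh : h ^+ 2 <= h * Num.sqrt h by rewrite expr2 ler_wpM2l// ltW.
set I := \int[_]_z _ in A *; set J := \int[_]_z _ in B *.
set MA := expR (- a) * _ in A; set MB := expR (- v) * _ in B H.
have MAE : MA = expR (- a) * (1 + h * k * a ^+ 2 + a ^+ 2 * h / 2).
  by rewrite /MA -/c -/k; field.
rewrite -MAE distrC in H.
apply: (le_trans (ler_distD MA _ _)).
rewrite [leRHS]mulrDl [X in _ <= X + _]mulrDl -addrA; apply: lerD => //.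
apply: (le_trans (ler_distD MB _ _)); apply: lerD; last by rewrite distrC.
apply: (le_trans H); apply: ler_pM; [| exact: sqr_ge0| |exact: hh].
  by have := sqr_ge0 k; have := expR_gt0 (1 : R); clear -k_gt0; lra.
have kk : k ^+ 2 <= k0 ^+ 2 by rewrite lerXn2r// nnegrE ltW.
by rewrite /C3; clear -kk0 kk; lra.
Qed.

End duality_kernel.

(** * Chains driven by independent increments *)

Section product_law.
Context d (T : measurableType d) {R : realType} (P : probability T R).
Variables (N : probability (measurableTypeR R) R).
Local Open Scope ereal_scope.

Lemma product_measure_scaler (M : probability (measurableTypeR R) R) (c : {nonneg R}) E :
  measurable E -> (M \x mscale c N) E = c%:num%:E * (M \x N) E.
Proof.
move=> mE; rewrite /product_measure1 /= -ge0_integralZl//.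
by move: (measurable_fun_xsection N mE).
Qed.

(** [D] stands for an event on later increments and [c] for its probability. Carrying both along
    lets independence of the future pass from rectangles to all measurable [E], by uniqueness of the
    product measure applied to [P] restricted to [D]. *)
Lemma law_pairE (X Y : {mfun T >-> measurableTypeR R}) (c : {nonneg R}) (D : set T) :
  measurable D ->
  (forall A B, measurable A -> measurable B ->
     P (X @^-1` A `&` Y @^-1` B `&` D) = P (X @^-1` A) * (c%:num%:E * N B)) ->
  forall E : set (measurableTypeR R * measurableTypeR R), measurable E ->
    P ((fun w => (X w, Y w)) @^-1` E `&` D) =
    c%:num%:E * (distribution P X \x N) E.
Proof.
move=> mD PXY E mE.
have mXY : measurable_fun setT (fun w => (X w, Y w)).
  by apply: measurable_fun_pair.
pose m' : {measure set (measurableTypeR R * measurableTypeR R) -> \bar R} :=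
  pushforward (mrestr P mD) (fun w => (X w, Y w)).
rewrite -product_measure_scaler//.
rewrite (@product_measure_unique _ _ _ _ _ _ _ (m' mXY))//.
Qed.

End product_law.

(** One clause gives both independence and the common law: [A i = setT] at the other indices
    isolates any finite family. *)
Definition iid_seq d (T : measurableType d) (R : realType) (P : probability T R)
    (N : probability (measurableTypeR R) R) (Z : nat -> T -> measurableTypeR R) :=
  (forall k, measurable_fun [set: T] (Z k)) /\
  forall (A : nat -> set (measurableTypeR R)) m, (forall i, measurable (A i)) ->
    (P (\bigcap_(i in `I_m) Z i @^-1` A i) = \prod_(i < m) N (A i))%E.

Section recursive_chain.
Context d (T : measurableType d) {R : realType} (P : probability T R).
Variables (N : probability (measurableTypeR R) R) (Z : nat -> T -> measurableTypeR R) (g : measurableTypeR R * measurableTypeR R -> measurableTypeR R) (x0 : measurableTypeR R).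
Hypothesis iidZ : iid_seq P N Z.
Hypothesis mg : measurable_fun [set: measurableTypeR R * measurableTypeR R] g.

Fixpoint rec_chain k (w : T) : measurableTypeR R :=
  if k is k'.+1 then g (rec_chain k' w, Z k' w) else x0.

Lemma measurable_rec_chain k : measurable_fun [set: T] (rec_chain k).
Proof.
elim: k => [|k IH] /=; first exact: measurable_cst.
by apply: measurableT_comp => //; apply: measurable_fun_pair => //; case: iidZ.
Qed.

Let chain_mfun k : {mfun T >-> measurableTypeR R} :=
  HB.pack (rec_chain k) (isMeasurableFun.Build _ _ _ _ _ (measurable_rec_chain k)).

Let Z_mfun k : {mfun T >-> measurableTypeR R} :=
  HB.pack (Z k) (isMeasurableFun.Build _ _ _ _ _ (iidZ.1 k)).

Local Open Scope ereal_scope.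

Let prod_fin_num m (C : nat -> set (measurableTypeR R)) : (forall i, measurable (C i)) ->
  exists c : {nonneg R}, \prod_(i < m) N (C i) = c%:num%:E.
Proof.
move=> mC; have p0 : 0 <= \prod_(i < m) N (C i) by apply: prode_ge0.
have pf : \prod_(i < m) N (C i) \is a fin_num.
  by apply: prode_fin_num => i _; exact: fin_num_measure.
by exists (NngNum (fine_ge0 p0)); rewrite /= fineK.
Qed.

(** The induction has to carry the [m] future increments, because the step from [k] to [k.+1]
    consumes [Z k], a future increment of the previous stage. The preimage of [A] under [g] is not a
    rectangle, hence the appeal to [law_pairE]. *)
Lemma rec_chain_indep k m (A : set (measurableTypeR R)) (C : nat -> set (measurableTypeR R)) :
  measurable A -> (forall i, measurable (C i)) ->
  P (rec_chain k @^-1` A `&` \bigcap_(i in `I_m) Z (k + i)%N @^-1` C i) =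
  P (rec_chain k @^-1` A) * \prod_(i < m) N (C i).
Proof.
elim: k m A C => [|k IH] m A C mA mC.
  have [Ax|nAx] := pselect (A x0).
    rewrite (_ : rec_chain 0 @^-1` A = setT); last by apply/seteqP; split => w.
    by rewrite setTI probability_setT mul1e; exact: iidZ.2.
  rewrite (_ : rec_chain 0 @^-1` A = set0); last by apply/seteqP; split => w.
  by rewrite set0I measure0 mul0e.
set D := \bigcap_(i in _) _.
have mD : measurable D.
  apply: fin_bigcap_measurable => [|i _]; first exact: finite_II.
  by rewrite -[X in measurable X]setTI; exact: iidZ.1.
pose E : set (measurableTypeR R * measurableTypeR R) := g @^-1` A.
have mE : measurable E by rewrite -[X in measurable X]setTI; exact: mg.
have [c cE] := prod_fin_num m mC.
have key (D' : set T) (c' : {nonneg R}) : measurable D' ->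
    (forall A B, measurable A -> measurable B ->
     P (rec_chain k @^-1` A `&` Z k @^-1` B `&` D') =
     P (rec_chain k @^-1` A) * (c'%:num%:E * N B)) ->
    P (rec_chain k.+1 @^-1` A `&` D') =
    c'%:num%:E * (distribution P (chain_mfun k) \x N) E.
  by move=> mD' H; apply: (law_pairE (X := chain_mfun k) (Y := Z_mfun k)).
have shift (B : set (measurableTypeR R)) j : measurable B ->
    \bigcap_(i in `I_j.+1) Z (k + i)%N @^-1` (if i is i'.+1 then C i' else B) =
    Z k @^-1` B `&` \bigcap_(i in `I_j) Z (k.+1 + i)%N @^-1` C i.
  move=> mB; apply/seteqP; split => w.
    move=> H; split; first by have := H 0%N isT; rewrite /= addn0.
    by move=> i ij; have := H i.+1 ij; rewrite /= addnS.
  by move=> [H0 H] [|i] ij /=; [rewrite addn0|rewrite addnS; exact: H].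
have step j (A' B : set (measurableTypeR R)) : measurable A' -> measurable B ->
    P (rec_chain k @^-1` A' `&` Z k @^-1` B `&`
       \bigcap_(i in `I_j) Z (k.+1 + i)%N @^-1` C i) =
    P (rec_chain k @^-1` A') * (N B * \prod_(i < j) N (C i)).
  move=> mA' mB; rewrite -setIA -shift// IH//; last by case.
  by rewrite big_ord_recl.
rewrite (key D c)//; last first.
  by move=> A' B mA' mB; rewrite step// cE [X in _ * X]muleC.
(* The same formula with an empty future gives the law of the chain at [k.+1] alone. *)
rewrite -(setIT (_ @^-1` A)) (key setT 1%:nng%R)//; last first.
  move=> A' B mA' mB; have := step 0%N _ _ mA' mB.
  by rewrite big_ord0 mule1 II0 bigcap_set0 mul1e.
by rewrite mul1e cE muleC.
Qed.

(** The Markov property: [Z k] is independent of the chain at time [k], so the pair has a product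
    law and Tonelli integrates the increment first. *)
Lemma integral_rec_chainS k (F : measurableTypeR R * measurableTypeR R -> \bar R) :
  measurable_fun [set: measurableTypeR R * measurableTypeR R] F -> (forall p, 0 <= F p) ->
  \int[P]_w F (rec_chain k w, Z k w) =
  \int[P]_w \int[N]_z F (rec_chain k w, z).
Proof.
move=> mF F0.
have mXY : measurable_fun setT (fun w => (rec_chain k w, Z k w)).
  by apply: measurable_fun_pair; [exact: measurable_rec_chain|exact: iidZ.1].
transitivity (\int[pushforward P (fun w => (rec_chain k w, Z k w))]_p F p).
  by rewrite ge0_integral_pushforward.
transitivity (\int[distribution P (chain_mfun k) \x N]_p F p).
  apply: eq_measure_integral => E mE _.
  have := @law_pairE _ _ _ P N (chain_mfun k) (Z_mfun k) 1%:nng%R setT measurableT.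
  rewrite /= /pushforward -(setIT (_ @^-1` E)) => -> //; first by rewrite mul1e.
  move=> A B mA mB; have := @rec_chain_indep k 1%N A (fun=> B) mA (fun=> mB).
  rewrite big_ord_recl big_ord0 mule1 mul1e setIT => <-; congr (P (_ `&` _)).
  apply/seteqP; split => w /= H; last by have := H 0%N isT; rewrite /= addn0.
  by move=> [|//] _; rewrite addn0.
rewrite fubini_tonelli1//.
rewrite ge0_integral_distribution//; first exact: measurable_fun_fubini_tonelli_F.
by move=> x; exact: integral_ge0.
Qed.

End recursive_chain.

Lemma brownian_increments_iid d (T : measurableType d) (R : realType)
    (P : probability T R) (B : R -> T -> R) (h : R) : 0 < h ->
  brownian_motion P B ->
  iid_seq P (normal_prob 0 (Num.sqrt h))
    (fun k w => B (k.+1%:R * h) w - B (k%:R * h) w).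
Proof.
move=> h0 [mB _ lawB indB].
have hk k : k%:R * h < k.+1%:R * h :> R by rewrite ltr_pM2r// ltr_nat.
split=> [k|A m mA]; first exact: measurable_funB.
have := indB m (fun k => k%:R * h) A; rewrite mul0r => /(_ (lexx 0) (fun i _ => hk i) mA).
rewrite (_ : \bigcap_(i in `I_m) [set w | B (i.+1%:R * h) w - B (i%:R * h) w \in A i] =
  \bigcap_(i in `I_m) (fun w => B (i.+1%:R * h) w - B (i%:R * h) w) @^-1` A i); last first.
  by apply: eq_bigcapr => i _; apply/seteqP; split => w /=; rewrite inE.
move=> ->; apply: eq_bigr => i _.
have i0 : 0 <= i%:R * h by rewrite mulr_ge0// ltW.
have iE : i.+1%:R * h - i%:R * h = h by rewrite -mulrBl -natrB// subSnn mul1r.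
by rewrite (lawB _ _ _ i0 (hk i) (mA i)) iE.
Qed.

Section measurability.
Context {R : realType}.

(** Inversion is expressed by the measurable [powR]. Squaring makes the base nonnegative, and the
    extra factor [x] gives the convention [0^-1 = 0]. *)
Lemma measurable_invr : measurable_fun [set: R] (@GRing.inv R).
Proof.
rewrite (_ : GRing.inv = (fun x : R => x * (x ^+ 2) `^ (-1))); last first.
  apply/funext => x; rewrite powR_inv1 ?sqr_ge0//.
  have [->|x0] := eqVneq x 0; first by rewrite invr0 mul0r.
  by rewrite expr2 invfM mulrA divff// mul1r.
apply: measurable_funM => //.
apply: (measurableT_comp (measurable_powR _)).
by apply: measurable_funX; exact: measurable_id.
Qed.

Lemma measurable_coshR : measurable_fun [set: R] (@coshR R).
Proof.
apply: measurable_funM => //; apply: measurable_funD => //.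
by apply: measurableT_comp => //; exact: measurableT_comp.
Qed.

Lemma measurable_cothR : measurable_fun [set: R] (@cothR R).
Proof.
apply: measurable_funM; first exact: measurable_coshR.
apply: measurableT_comp; first exact: measurable_invr.
apply: measurable_funM => //; apply: measurable_funB => //.
by apply: measurableT_comp => //; exact: measurableT_comp.
Qed.

End measurability.

Lemma integral_probability_cst d (T : measurableType d) (R : realType)
  (P : probability T R) (c : \bar R) : (\int[P]_w c = c)%E.
Proof.
transitivity (\int[P]_w (cst c) w)%E => //.
by rewrite integral_cst// [X in (_ * X)%E](probability_setT P) mule1.
Qed.

(** * Exchange of steps between two chains *)

Section telescope.
Context d (T : measurableType d) {R : realType} (P : probability T R).
Local Notation RT := (measurableTypeR R).
Variables (N : probability RT R) (Z : nat -> T -> RT).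
Variables (g : RT * RT -> RT) (x0 : RT).
Hypothesis iidZ : iid_seq P N Z.
Hypothesis mg : measurable_fun [set: RT * RT] g.
Variables (psi : nat -> RT -> \bar R) (e : R).
Hypothesis e0 : 0 <= e.
Hypothesis psi0 : forall m x, (0 <= psi m x)%E.
Hypothesis mpsi : forall m, measurable_fun [set: RT] (psi m).
Local Open Scope ereal_scope.
Local Notation X := (rec_chain Z g x0).

Let mpsig m : measurable_fun [set: RT * RT] (fun p => psi m (g p)).
Proof. exact: measurableT_comp (mpsi m) mg. Qed.

Let mpsiX m k : measurable_fun [set: T] (fun w => psi m (X k w)).
Proof. exact: measurableT_comp (mpsi m) (measurable_rec_chain _ iidZ mg k). Qed.

Let mpsigX m k :
  measurable_fun [set: T] (fun w => \int[N]_z psi m (g (X k w, z))).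
Proof.
have mF := measurable_fun_fubini_tonelli_F (m2 := N) _ (mpsig m) (fun p => psi0 m (g p)).
exact: measurableT_comp mF (measurable_rec_chain _ iidZ mg k).
Qed.

Let intD (f : T -> \bar R) : measurable_fun [set: T] f -> (forall w, 0 <= f w) ->
  \int[P]_w (f w + e%:E) = \int[P]_w f w + e%:E.
Proof.
move=> mf f0; rewrite ge0_integralD//.
by rewrite integral_probability_cst.
Qed.

Let intS m k : \int[P]_w psi m (X k.+1 w) =
  \int[P]_w \int[N]_z psi m (g (X k w, z)).
Proof.
exact: (integral_rec_chainS x0 iidZ mg k (mpsig m) (fun p => psi0 m (g p))).
Qed.

(** The index of [psi] counts the steps already handed over to the dual chain: each step taken away
    from [X] raises it by one at the price [e], until only the starting point is left. The two
    inequalities are kept apart because they are used with different functions [psi]. *)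
Lemma rec_chain_le k m :
  (forall m x, \int[N]_z psi m (g (x, z)) <= psi m.+1 x + e%:E) ->
  \int[P]_w psi m (X k w) <= psi (m + k)%N x0 + (k%:R * e)%:E.
Proof.
move=> step; elim: k m => [|k IH] m.
  have -> : \int[P]_w psi m (X 0 w) = psi m x0 := integral_probability_cst P (psi m x0).
  by rewrite addn0 mul0r adde0.
rewrite intS.
apply: (@le_trans _ _ (\int[P]_w (psi m.+1 (X k w) + e%:E))).
  by apply: ge0_le_integral => //; [move=> *; exact: integral_ge0|exact: emeasurable_funD].
rewrite intD// (le_trans (leeD2r _ (IH _)))// -addeA -EFinD addSnnS.
by rewrite -natr1 mulrDl mul1r.
Qed.

Lemma rec_chain_ge k m :
  (forall m x, psi m.+1 x <= \int[N]_z psi m (g (x, z)) + e%:E) ->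
  psi (m + k)%N x0 <= \int[P]_w psi m (X k w) + (k%:R * e)%:E.
Proof.
move=> step; elim: k m => [|k IH] m.
  have -> : \int[P]_w psi m (X 0 w) = psi m x0 := integral_probability_cst P (psi m x0).
  by rewrite addn0 mul0r adde0.
rewrite intS.
rewrite -addSnnS (le_trans (IH _))//.
apply: (@le_trans _ _ (\int[P]_w (\int[N]_z psi m (g (X k w, z)) + e%:E)
    + (k%:R * e)%:E)).
  by rewrite leeD2r//; apply: ge0_le_integral => //; exact: emeasurable_funD.
rewrite intD//; last by move=> *; exact: integral_ge0.
by rewrite -addeA -EFinD -nat1r mulrDl mul1r.
Qed.

End telescope.

(** * Duality for the discretized processes *)

Section discrete_duality.
Context {R : realType}.
Local Notation RT := (measurableTypeR R).
Variables (beta eps h : R).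

(** A scale function of the diffusion: [phi'' / 2 - coth phi' / 2 = 0]. This is the [Y] of the
    duality as a function of the position. *)
Definition bessel_potential (x : R) : R := beta * (coshR x - 1).

Definition Gamma_step (p : RT * RT) : RT :=
  p.1 * expR (p.2 - h / 2) / (1 + beta * h * p.1).

(** At or below [eps] the chain is frozen. The absolute value keeps an overshoot below 0 nonnegative
    and, [cosh] being even, does not change the potential, so that the kernel estimate, stated
    without it, still applies. *)
Definition Euler_step (p : RT * RT) : RT :=
  if eps < p.1 then `|p.1 + p.2 - cothR p.1 / 2 * h| else p.1.

(** A frozen chain is counted as absorbed at 0, where the potential vanishes and the payoff is 1. *)
Definition stopped_payoff (x : R) : R :=
  if eps < x then expR (- bessel_potential x) else 1.

Local Notation phi := bessel_potential.

Lemma measurable_Gamma_step : measurable_fun [set: RT * RT] Gamma_step.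
Proof.
apply: measurable_funM.
  apply: measurable_funM; first exact: measurable_fst.
  apply: (measurableT_comp (@measurable_expR R)).
  apply: measurable_funB; last exact: measurable_cst.
  exact: measurable_snd.
apply: (measurableT_comp (@measurable_invr R)).
apply: measurable_funD; first exact: measurable_cst.
by apply: measurable_funM; [exact: measurable_cst|exact: measurable_fst].
Qed.

Lemma measurable_Euler_step : measurable_fun [set: RT * RT] Euler_step.
Proof.
have m1 : measurable_fun [set: RT * RT] (fun p : RT * RT => p.1 : R) by exact: measurable_fst.
have m2 : measurable_fun [set: RT * RT] (fun p : RT * RT => p.2 : R) by exact: measurable_snd.
apply: measurable_fun_ifT.
- by apply: measurable_fun_ltr => //; exact: measurable_cst.
- apply: (measurableT_comp (@normr_measurable R setT)).
  apply: measurable_funB; first exact: measurable_funD.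
  apply: measurable_funM; last exact: measurable_cst.
  apply: measurable_funM; last exact: measurable_cst.
  exact: measurableT_comp measurable_cothR m1.
- exact: m1.
Qed.

Lemma measurable_potential : measurable_fun [set: RT] phi.
Proof.
apply: measurable_funM; first exact: measurable_cst.
apply: measurable_funB; last exact: measurable_cst.
exact: measurable_coshR.
Qed.

Hypothesis beta0 : 0 < beta.
Hypothesis h0 : 0 < h.
Variable C : R.
Hypothesis C0 : 0 <= C.
Hypothesis kernelC : forall x g : R, eps <= x -> 0 <= g ->
  `|\int[normal_prob 0 (Num.sqrt h)]_z
      expR (- (g * (beta * (coshR (x + z - cothR x / 2 * h) - 1)))) -
    \int[normal_prob 0 (Num.sqrt h)]_z
      expR (- (beta * (coshR x - 1) *
               (g * expR (z - h / 2) / (1 + beta * h * g))))|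
  <= C * (h * Num.sqrt h).

Lemma bessel_potential_ge0 x : 0 <= phi x.
Proof. by rewrite mulr_ge0 ?(ltW beta0)// subr_ge0 coshR_ge1. Qed.

Let N : probability RT R := normal_prob 0 (Num.sqrt h).
Let e := C * (h * Num.sqrt h).

Let e_ge0 : 0 <= e.
Proof. by rewrite !mulr_ge0 ?sqrtr_ge0// ltW. Qed.

Let mphi_shift (x : R) :
  measurable_fun [set: RT] (fun z : RT => phi (x + z - cothR x / 2 * h)).
Proof.
apply: (measurableT_comp measurable_potential).
apply: measurable_funB; last exact: measurable_cst.
by apply: measurable_funD; [exact: measurable_cst|exact: measurable_id].
Qed.

Let mexpN d (T : measurableType d) (f : T -> R) : measurable_fun [set: T] f ->
  measurable_fun [set: T] (fun w => (expR (- f w))%:E).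
Proof.
move=> mf; apply/measurable_EFinP.
by apply: (measurableT_comp (@measurable_expR R)); exact: measurable_funN.
Qed.

Let mGs (g : R) : measurable_fun [set: RT] (fun z : RT => Gamma_step (g, z)).
Proof.
exact: measurableT_comp measurable_Gamma_step (pair1_measurable _).
Qed.

Lemma Gamma_step_ge0 g z : 0 <= g -> 0 <= Gamma_step (g, z).
Proof.
move=> g0; rewrite divr_ge0//= ?mulr_ge0 ?expR_ge0//.
by rewrite addr_ge0// !mulr_ge0// ltW.
Qed.

Local Open Scope ereal_scope.

Let intE (f : RT -> R) : measurable_fun [set: RT] f -> (forall z, (0 <= f z)%R) ->
  \int[N]_z (expR (- f z))%:E = (Rintegral N setT (fun z => expR (- f z)))%:E.
Proof.
move=> mf f0; rewrite /Rintegral fineK//; apply: integrable_fin_num => //.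
apply: integrable_normal_bounded.
  by apply: (measurableT_comp (@measurable_expR R)); exact: measurable_funN.
by move=> z; rewrite expR_ge0 expR_le1 oppr_le0 f0.
Qed.

Let kernelE x g : (eps <= x)%R -> (0 <= g)%R ->
  \int[N]_z (expR (- (g * phi (x + z - cothR x / 2 * h))))%:E <=
  \int[N]_z (expR (- (phi x * Gamma_step (g, z))))%:E + e%:E /\
  \int[N]_z (expR (- (phi x * Gamma_step (g, z))))%:E <=
  \int[N]_z (expR (- (g * phi (x + z - cothR x / 2 * h))))%:E + e%:E.
Proof.
move=> ex g0.
rewrite (@intE (fun z => g * phi (x + z - cothR x / 2 * h))%R); last 2 first.
- by apply: measurable_funM; [exact: measurable_cst|exact: mphi_shift].
- by move=> z; rewrite mulr_ge0// bessel_potential_ge0.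
rewrite (@intE (fun z => phi x * Gamma_step (g, z))%R); last 2 first.
- by apply: measurable_funM; [exact: measurable_cst|exact: mGs].
- by move=> z; rewrite mulr_ge0 ?bessel_potential_ge0 ?Gamma_step_ge0.
have [k1 k2] := ler_normlW2 (kernelC ex g0).
rewrite -!EFinD !lee_fin -!lerBlDl; split; first exact: k2.
by rewrite -lerN2 opprB; exact: k1.
Qed.

Context d (T : measurableType d) (P : probability T R).
Variable Z : nat -> T -> RT.
Hypothesis iidZ : iid_seq P N Z.

Let G := rec_chain Z Gamma_step 1%R.

Let mG k : measurable_fun [set: T] (G k).
Proof. exact: (measurable_rec_chain 1%R iidZ measurable_Gamma_step k). Qed.

Let G_ge0 k w : (0 <= G k w)%R.
Proof. by elim: k => [|k IH] //=; exact: Gamma_step_ge0. Qed.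

Let mexp1 : measurable_fun [set: RT] (fun z : RT => expR (1 * z + - (h / 2)))%R.
Proof.
apply: (measurableT_comp (@measurable_expR R)).
apply: measurable_funD; last exact: measurable_cst.
by apply: measurable_funM; [exact: measurable_cst|exact: measurable_id].
Qed.

(** The supermartingale property: [expR (z - h / 2)] has mean 1 and the denominator of [Gamma_step]
    is at least 1. *)
Let EG_le1 k : \int[P]_w (G k w)%:E <= 1.
Proof.
elim: k => [|k IH].
  by have -> : \int[P]_w (G 0 w)%:E = 1 := integral_probability_cst P 1.
(* The absolute value provides the nonnegativity on the whole plane that [integral_rec_chainS] asks
   for; along the chain it changes nothing. *)
have mF : measurable_fun [set: RT * RT] (fun p => `|Gamma_step p|%:E).
  apply/measurable_EFinP; apply: (measurableT_comp (@normr_measurable R setT)).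
  exact: measurable_Gamma_step.
have := integral_rec_chainS 1%R iidZ measurable_Gamma_step k mF (fun p => normr_ge0 _).
rewrite -/G => GS.
have -> : \int[P]_w (G k.+1 w)%:E = \int[P]_w (`|Gamma_step (G k w, Z k w)|%:E).
  by apply: eq_integral => w _; rewrite ger0_norm//; exact: (G_ge0 k.+1).
rewrite GS; apply: le_trans IH; apply: ge0_le_integral => //.
- by move=> w _; exact: integral_ge0.
- have := measurable_fun_fubini_tonelli_F (m2 := N) _ mF (fun p => normr_ge0 _).
  by move=> mFF; exact: measurableT_comp mFF (mG k).
- by apply/measurable_EFinP; exact: mG.
move=> w _.
apply: (@le_trans _ _ (\int[N]_z ((G k w)%:E * (expR (1 * z + - (h / 2)))%:E))).
  apply: ge0_le_integral => //.
  - apply/measurable_EFinP; apply: (measurableT_comp (@normr_measurable R setT)).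
    exact: mGs.
  - apply/measurable_EFinP; apply: measurable_funM; first exact: measurable_cst.
    exact: mexp1.
  - move=> z _; rewrite lee_fin ger0_norm ?Gamma_step_ge0// mul1r.
    rewrite /Gamma_step/= ler_pdivrMr ?ltr_pwDl// ?mulr_ge0// ?(ltW h0) ?(ltW beta0)//.
    rewrite ler_peMr ?mulr_ge0 ?expR_ge0// lerDl !mulr_ge0// ltW//.
rewrite ge0_integralZl//; last 2 first.
- by apply/measurable_EFinP; exact: mexp1.
- by rewrite lee_fin.
rewrite [X in _ * X](_ : _ = 1) ?mule1//.
rewrite [LHS](integral_normal_expR 1 (- (h / 2)) h0).
by congr EFin; rewrite expr1n mul1r addrN expR0.
Qed.

Let u m y := \int[P]_w (expR (- (G m w * y)))%:E.

Let u_ge0 m y : 0 <= u m y.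
Proof. by apply: integral_ge0 => w _; rewrite lee_fin expR_ge0. Qed.

Let mGy m y : measurable_fun [set: T] (fun w => (expR (- (G m w * y)))%:E).
Proof.
by apply: mexpN; apply: measurable_funM; [exact: mG|exact: measurable_cst].
Qed.

Let u_le1 m y : (0 <= y)%R -> u m y <= 1.
Proof.
move=> y0; rewrite -[leRHS](integral_probability_cst P); apply: ge0_le_integral => // w _.
by rewrite lee_fin expR_le1 oppr_le0 mulr_ge0.
Qed.

(** From [1 - expR (- G y) <= G y] and [EG_le1]: freezing at potential [y] and paying 1 costs at
    most [y]. *)
Let u_ge1 m y : (0 <= y)%R -> 1 <= u m y + y%:E.
Proof.
move=> y0; rewrite -[leLHS](integral_probability_cst P).
have mGE : measurable_fun [set: T] (fun w => (G m w)%:E).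
  by apply/measurable_EFinP; exact: mG.
have GE0 w : 0 <= (G m w)%:E by rewrite lee_fin.
have y0' : 0 <= y%:E by rewrite lee_fin.
have myG : measurable_fun [set: T] (fun w => y%:E * (G m w)%:E).
  by apply: emeasurable_funM => //; exact: measurable_cst.
apply: (@le_trans _ _ (\int[P]_w ((expR (- (G m w * y)))%:E + y%:E * (G m w)%:E))).
  apply: ge0_le_integral => //.
  - by apply: emeasurable_funD => //; exact: mGy.
  - move=> w _; rewrite -EFinM -EFinD lee_fin.
    have e1 := expR_ge1Dx (- (G m w * y)).
    by rewrite [(y * _)%R]mulrC -lerBlDr.
rewrite ge0_integralD//; last by move=> w _; rewrite mule_ge0.
rewrite leeD2l// ge0_integralZl//.
by rewrite -[leRHS]mule1 lee_wpmul2l.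
Qed.

Let mF y : measurable_fun [set: RT * RT]
  (fun p => (expR (- (Gamma_step p * y)))%:E).
Proof.
apply: mexpN; apply: measurable_funM; last exact: measurable_cst.
exact: measurable_Gamma_step.
Qed.

Let uS m y :
  u m.+1 y = \int[P]_w \int[N]_z (expR (- (y * Gamma_step (G m w, z))))%:E.
Proof.
have F0 (p : RT * RT) : 0 <= (expR (- (Gamma_step p * y)))%:E.
  by rewrite lee_fin expR_ge0.
rewrite [LHS](integral_rec_chainS 1%R iidZ measurable_Gamma_step m (mF y) F0).
by apply: eq_integral => w _; apply: eq_integral => z _; rewrite mulrC.
Qed.

Let mstepG m y : measurable_fun [set: T]
  (fun w => \int[N]_z (expR (- (y * Gamma_step (G m w, z))))%:E).
Proof.
have mF' : measurable_fun [set: RT * RT]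
    (fun p => (expR (- (y * Gamma_step p)))%:E).
  apply: mexpN; apply: measurable_funM; first exact: measurable_cst.
  exact: measurable_Gamma_step.
have F0 (p : RT * RT) : 0 <= (expR (- (y * Gamma_step p)))%:E.
  by rewrite lee_fin expR_ge0.
have mFF := measurable_fun_fubini_tonelli_F (m2 := N) _ mF' F0.
exact: measurableT_comp mFF (mG m).
Qed.

Let intD (f : T -> \bar R) : measurable_fun [set: T] f -> (forall w, 0 <= f w) ->
  \int[P]_w (f w + e%:E) = \int[P]_w f w + e%:E.
Proof.
by move=> mf f0; rewrite ge0_integralD// (integral_probability_cst P).
Qed.

(** By Tonelli the Gaussian variable of the Euler step is integrated first, with the value
    [g = G m w] of the other chain held fixed. [kernelE] trades it for one more step of [Gamma],
    uniformly in [w], and [uS] recognizes [u m.+1]. *)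
Let u_step m x : (eps <= x)%R ->
  \int[N]_z u m (phi (x + z - cothR x / 2 * h)) <= u m.+1 (phi x) + e%:E /\
  u m.+1 (phi x) <= \int[N]_z u m (phi (x + z - cothR x / 2 * h)) + e%:E.
Proof.
move=> ex.
pose f (p : RT * T) := (expR (- (G m p.2 * phi (x + p.1 - cothR x / 2 * h))))%:E.
have mf : measurable_fun [set: RT * T] f.
  apply: mexpN; apply: measurable_funM.
    exact: measurableT_comp (mG m) measurable_snd.
  exact: measurableT_comp (mphi_shift x) measurable_fst.
have f0 p : 0 <= f p by rewrite lee_fin expR_ge0.
have swap : \int[N]_z u m (phi (x + z - cothR x / 2 * h)) =
    \int[P]_w \int[N]_z f (z, w).
  exact: (fubini_tonelli (m1 := N) (m2 := P) f mf f0).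
have mfG := measurable_fun_fubini_tonelli_G (m1 := N) f mf f0.
rewrite swap uS; split.
- rewrite -intD//; last by move=> w; apply: integral_ge0 => z _; rewrite lee_fin expR_ge0.
  apply: ge0_le_integral => //.
  + by move=> w _; exact: integral_ge0.
  + by apply: emeasurable_funD => //; exact: measurable_cst.
  + by move=> w _; have [+ _] := kernelE ex (G_ge0 m w).
- rewrite -intD//; last by move=> w; exact: integral_ge0.
  apply: ge0_le_integral => //.
  + by move=> w _; apply: integral_ge0 => z _; rewrite lee_fin expR_ge0.
  + by apply: emeasurable_funD => //; exact: measurable_cst.
  + by move=> w _; have [_ +] := kernelE ex (G_ge0 m w).
Qed.

(** Freezing replaces [u m (phi x)] by 1, an error between 0 and [phi eps]. Up to [e] per step,
    [c = phi eps] makes [psi] a supersolution by [u_ge1], and [c = 0] a subsolution by [u_le1]. The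
    cost of stopping is thereby paid once and not at every step. *)
Let psi (c : R) m (x : RT) := if (eps < x)%R then u m (phi x) + c%:E else 1.

Let mu m : measurable_fun [set: RT] (fun x : RT => u m (phi x)).
Proof.
pose f (p : RT * T) := (expR (- (G m p.2 * p.1)))%:E.
have mf : measurable_fun [set: RT * T] f.
  apply: mexpN; apply: measurable_funM; last exact: measurable_fst.
  exact: measurableT_comp (mG m) measurable_snd.
have f0 p : 0 <= f p by rewrite lee_fin expR_ge0.
have mfF := measurable_fun_fubini_tonelli_F (m2 := P) f mf f0.
exact: measurableT_comp mfF measurable_potential.
Qed.

Let mpsi c m : measurable_fun [set: RT] (psi c m).
Proof.
apply: measurable_fun_ifT => //.
- by apply: measurable_fun_ltr; [exact: measurable_cst|exact: measurable_id].
- by apply: emeasurable_funD; [exact: mu|exact: measurable_cst].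
Qed.

Let psi0 c m x : (0 <= c)%R -> 0 <= psi c m x.
Proof. by move=> c0; rewrite /psi; case: ifPn => // _; rewrite adde_ge0. Qed.

Let potential_norm x : phi `|x| = phi x.
Proof. by rewrite /bessel_potential coshR_norm. Qed.

Let potential_le x : (0 <= x)%R -> (x <= eps)%R -> (phi x <= phi eps)%R.
Proof. by move=> x0 xe; rewrite ler_wpM2l ?(ltW beta0)// lerD2r ler_coshR. Qed.

Let int_psi_absorbed c m x : ~~ (eps < x)%R ->
  \int[N]_z psi c m (Euler_step (x, z)) = 1.
Proof.
move=> ex; under eq_integral do rewrite /psi /Euler_step/= (negbTE ex) (negbTE ex).
exact: integral_probability_cst.
Qed.

Let mshift m x : measurable_fun [set: RT] (fun z : RT => u m (phi (x + z - cothR x / 2 * h))).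
Proof.
have mz : measurable_fun [set: RT] (fun z : RT => x + z - cothR x / 2 * h : RT)%R.
  apply: measurable_funB; last exact: measurable_cst.
  by apply: measurable_funD; [exact: measurable_cst|exact: measurable_id].
exact: measurableT_comp (mu m) mz.
Qed.

Let mpsiE c m x : measurable_fun [set: RT] (fun z : RT => psi c m (Euler_step (x, z))).
Proof.
have mE : measurable_fun [set: RT] (fun z : RT => Euler_step (x, z)).
  exact: measurableT_comp measurable_Euler_step (pair1_measurable _).
exact: measurableT_comp (mpsi c m) mE.
Qed.

Let psi_up m x : \int[N]_z psi (phi eps) m (Euler_step (x, z)) <=
  psi (phi eps) m.+1 x + e%:E.
Proof.
have c0 := bessel_potential_ge0 eps.
have [ex|ex] := boolP (eps < x)%R; last first.
  by rewrite int_psi_absorbed// /psi (negbTE ex) leeDl// lee_fin.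
rewrite {2}/psi ex.
apply: (@le_trans _ _
    (\int[N]_z (u m (phi (x + z - cothR x / 2 * h)) + (phi eps)%:E))).
  apply: ge0_le_integral => //.
  - by move=> z _; exact: psi0.
  - by apply: emeasurable_funD => //; exact: measurable_cst.
  - move=> z _; rewrite /Euler_step/= ex /psi; case: ifPn => [_|].
      by rewrite potential_norm.
    rewrite -leNgt => le; rewrite -potential_norm.
    apply: (le_trans (u_ge1 m (bessel_potential_ge0 `|x + z - cothR x / 2 * h|%R))).
    by rewrite leeD2l// lee_fin potential_le.
rewrite ge0_integralD// (integral_probability_cst N) addeAC leeD2r//.
by have [+ _] := u_step m (ltW ex).
Qed.

Let psi_lo m x : psi 0 m.+1 x <=
  \int[N]_z psi 0 m (Euler_step (x, z)) + e%:E.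
Proof.
have [ex|ex] := boolP (eps < x)%R; last first.
  by rewrite int_psi_absorbed// /psi (negbTE ex) leeDl// lee_fin.
rewrite {1}/psi ex adde0.
have [_ +] := u_step m (ltW ex); move=> /le_trans; apply.
rewrite leeD2r//; apply: ge0_le_integral => //.
move=> z _; rewrite /Euler_step/= ex /psi; case: ifPn => [_|_].
  by rewrite potential_norm adde0.
by rewrite u_le1// bessel_potential_ge0.
Qed.

Context d' (T' : measurableType d') (Q : probability T' R).
Variable Z' : nat -> T' -> RT.
Hypothesis iidZ' : iid_seq Q N Z'.
Variable x0 : R.
Hypothesis x0_ge0 : (0 <= x0)%R.

Lemma measurable_stopped_payoff : measurable_fun [set: RT] stopped_payoff.
Proof.
apply: measurable_fun_ifT.
- by apply: measurable_fun_ltr; [exact: measurable_cst|exact: measurable_id].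
- apply: (measurableT_comp (@measurable_expR R)).
  exact: measurable_funN measurable_potential.
- exact: measurable_cst.
Qed.

Let mpay n : measurable_fun [set: T']
  (fun w => (stopped_payoff (rec_chain Z' Euler_step x0 n w))%:E).
Proof.
apply/measurable_EFinP; apply: (measurableT_comp measurable_stopped_payoff).
exact: (measurable_rec_chain _ iidZ' measurable_Euler_step n).
Qed.

Let pay0 x : (0 <= stopped_payoff x)%R.
Proof. by rewrite /stopped_payoff; case: ifPn => // _; exact: expR_ge0. Qed.

Let u0 y : u 0 y = (expR (- y))%:E.
Proof.
by rewrite /u/= /G/= mul1r (integral_probability_cst P).
Qed.

Let mpsiX c n : measurable_fun [set: T']
  (fun w => psi c 0 (rec_chain Z' Euler_step x0 n w)).
Proof.
exact: measurableT_comp (mpsi c 0)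
  (measurable_rec_chain _ iidZ' measurable_Euler_step n).
Qed.

Lemma discrete_duality_le n :
  \int[Q]_w (stopped_payoff (rec_chain Z' Euler_step x0 n w))%:E <=
  \int[P]_w (expR (- (rec_chain Z Gamma_step 1 n w * phi x0)))%:E +
    (phi eps + n%:R * (C * (h * Num.sqrt h)))%:E.
Proof.
have c0 := bessel_potential_ge0 eps.
apply: (@le_trans _ _ (\int[Q]_w psi (phi eps) 0 (rec_chain Z' Euler_step x0 n w))).
  apply: ge0_le_integral => //; first by move=> w _; rewrite lee_fin.
  move=> w _; rewrite /psi /stopped_payoff; case: ifPn => // _.
  by rewrite u0 -EFinD lee_fin lerDl.
have := rec_chain_le x0 iidZ' measurable_Euler_step e_ge0
  (fun m x => psi0 m x c0) (mpsi (phi eps)) n 0 psi_up.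
move=> /le_trans; apply; rewrite add0n EFinD addeA leeD2r//.
rewrite /psi; case: ifPn => // ex.
apply: (le_trans (u_ge1 n (bessel_potential_ge0 x0))).
by rewrite leeD2l// lee_fin potential_le// leNgt.
Qed.

Lemma discrete_duality_ge n :
  \int[P]_w (expR (- (rec_chain Z Gamma_step 1 n w * phi x0)))%:E <=
  \int[Q]_w (stopped_payoff (rec_chain Z' Euler_step x0 n w))%:E +
    (n%:R * (C * (h * Num.sqrt h)))%:E.
Proof.
have := rec_chain_ge x0 iidZ' measurable_Euler_step e_ge0
  (fun m x => psi0 m x (lexx 0%R)) (mpsi 0) n 0 psi_lo.
rewrite add0n => ge; apply: (@le_trans _ _ (psi 0 n x0)).
  rewrite /psi; case: ifPn => _; first by rewrite adde0.
  by rewrite u_le1// bessel_potential_ge0.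
apply: (le_trans ge); rewrite leeD2r//; apply: ge0_le_integral => //; first by move=> w _; exact: psi0.
move=> w _; rewrite /psi /stopped_payoff; case: ifPn => // _.
  by rewrite u0 adde0.
Qed.

End discrete_duality.

(** * Continuous paths and their discretizations *)

Section path_analysis.
Context {R : realType}.
Implicit Types (f g : R -> R) (A : set R) (s t x y : R).
Local Notation mu := (@lebesgue_measure R).

Lemma within_continuous_epsP A f : {within A, continuous f} <->
  forall x, A x -> forall e, 0 < e -> exists2 d, 0 < d &
    forall y, A y -> `|x - y| < d -> `|f x - f y| < e.
Proof.
split=> [/subspace_continuousP cf x Ax e e0|H].
  have /cvgrPdist_lt /(_ e e0) := cf x Ax.
  rewrite near_withinE => -[d /= d0 dP]; exists d => // y Ay xy.
  exact: dP.
apply/subspace_continuousP => x Ax; apply/cvgrPdist_lt => e e0.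
have [d d0 dP] := H x Ax e e0.
by rewrite near_withinE; exists d => //= y xy Ay; exact: dP.
Qed.

Lemma within_continuous_dominated A f g K : 0 <= K -> {within A, continuous f} ->
  (forall x y, A x -> A y -> `|g x - g y| <= K * `|f x - f y|) ->
  {within A, continuous g}.
Proof.
move=> K0 /within_continuous_epsP cf fg; apply/within_continuous_epsP => x Ax e e0.
have K1 : 0 < K + 1 by rewrite ltr_wpDl.
have [d d0 dP] := cf x Ax (e / (K + 1)) (divr_gt0 e0 K1).
exists d => // y Ay xy; apply: le_lt_trans (fg x y Ax Ay) _.
have := dP y Ay xy; rewrite ltr_pdivlMr// => /(le_lt_trans _); apply.
by rewrite mulrC ler_wpM2l// lerDl.
Qed.

(** Heine's theorem, from compactness as a near-covering property: the local radii are merged by the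
    filter of right neighbourhoods of 0 in which [d] lives. *)
Lemma within_continuous_uniform f t : {within `[0, t], continuous f} ->
  forall e, 0 < e -> exists2 d, 0 < d &
    forall x y, 0 <= x <= t -> 0 <= y <= t -> `|x - y| < d -> `|f x - f y| < e.
Proof.
move=> /within_continuous_epsP cf e e0.
have e20 : 0 < e / 2 by rewrite divr_gt0.
have /compact_near_coveringP cpt := @segment_compact R 0 t.
pose P (d x : R) := 0 <= x <= t ->
  forall y, 0 <= y <= t -> `|x - y| < d -> `|f x - f y| < e.
have [|d0 /= d00 dP] := cpt _ (0^'+) P _.
  move=> x; rewrite /= in_itv/= => xt.
  have [d d0 dP] := cf x xt _ e20.
  have d20 : 0 < d / 2 by rewrite divr_gt0.
  exists (ball x (d / 2), [set s | s < d / 2]).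
    split; first exact: nbhsx_ballx.
    exact: nbhs_right_lt.
  move=> [x' s] [/= xx' sd] x't y yt x'y.
  have fx' : `|f x - f x'| < e / 2.
    by apply: dP; [rewrite /= in_itv|rewrite (lt_le_trans xx')// ler_pdivrMr// ler_peMr// ?ler1n// ltW].
  have fy : `|f x - f y| < e / 2.
    apply: dP; first by rewrite /= in_itv.
    rewrite (le_lt_trans (ler_distD x' _ _))// [ltRHS](splitr d) ltrD//.
    exact: lt_trans sd.
  rewrite (le_lt_trans (ler_distD (f x) _ _))// [ltRHS](splitr e) ltrD//.
  by rewrite distrC.
exists (d0 / 2); first by rewrite divr_gt0.
move=> x y xt yt xy; apply: (dP (d0 / 2)) => //=.
- by rewrite sub0r normrN gtr0_norm ?divr_gt0// ltr_pdivrMr// ltr_pMr// ltr1n.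
- by rewrite divr_gt0.
Qed.

Lemma within_continuous_segment f t :
  {within [set s | 0 <= s], continuous f} -> {within `[0, t], continuous f}.
Proof.
by apply: continuous_subspaceW => s /=; rewrite in_itv/= => /andP[].
Qed.

Lemma within_continuous_le f (r t : R) : r <= t ->
  {within `[0, t], continuous f} -> {within `[0, r], continuous f}.
Proof.
move=> rt; apply: continuous_subspaceW => s /=.
by rewrite !in_itv/= => /andP[-> sr]; exact: le_trans rt.
Qed.

Lemma Rintegral_increment_le f (a b c e t : R) :
  {within `[0, t], continuous f} -> 0 <= a -> a <= b -> b <= t ->
  (forall s, a <= s <= b -> `|f s - c| <= e) ->
  `|\int[mu]_(s in `[0, b]) f s - \int[mu]_(s in `[0, a]) f s - (b - a) * c|
  <= (b - a) * e.
Proof.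
move=> cf a0 ab bt fc.
have intb : mu.-integrable `[0, b] (EFin \o f).
  apply: continuous_compact_integrable; first exact: segment_compact.
  exact: within_continuous_le bt cf.
rewrite Rintegral_itvB ?bnd_simp//.
have mab : measurable `]a, b] by exact: measurable_itv.
have muab : mu `]a, b] = (b - a)%:E.
  rewrite lebesgue_measure_itv/= lte_fin; case: ltP => //.
  by move=> ba; rewrite (_ : b = a) ?subrr//; apply/eqP; rewrite eq_le ab ba.
have iab : mu.-integrable `]a, b] (EFin \o f).
  apply: integrableS intb => //= s /=; rewrite !in_itv/= => /andP[as_ ->].
  by rewrite andbT (le_trans a0)// ltW.
have icst (k : R) : mu.-integrable `]a, b] (EFin \o cst k).
  apply: measurable_bounded_integrable => //.
    by rewrite [X in (X < _)%E]muab ltry.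
  exists `|k|; split; first exact: num_real.
  by move=> M kM s _ /=; exact: ltW.
have cstE (k : R) : \int[mu]_(s in `]a, b]) cst k s = (b - a) * k.
  by rewrite [LHS]Rintegral_cst// [X in _ * fine X]muab mulrC.
rewrite -cstE -RintegralB//.
apply: le_trans (le_normr_Rintegral _ _) _ => //.
  rewrite (_ : EFin \o _ = (EFin \o f) \- (EFin \o cst c))%E; first exact: integrableB.
  by apply/funext => s; rewrite /= EFinB.
rewrite -cstE; apply: le_Rintegral => //.
- apply: integrable_norm.
  rewrite (_ : EFin \o _ = (EFin \o f) \- (EFin \o cst c))%E; first exact: integrableB.
  by apply/funext => s; rewrite /= EFinB.
- by move=> s /=; rewrite in_itv/= => /andP[as_ sb]; apply: fc; rewrite sb ltW.
Qed.

Lemma Riemann_sum_le f (h e : R) n : 0 <= h ->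
  {within `[0, n%:R * h], continuous f} ->
  (forall s r, 0 <= s <= n%:R * h -> 0 <= r <= n%:R * h -> `|s - r| <= h ->
     `|f s - f r| <= e) ->
  `|\int[mu]_(s in `[0, n%:R * h]) f s - h * \sum_(k < n) f (k%:R * h)|
  <= n%:R * h * e.
Proof.
move=> h0 cf fe.
suff H m : (m <= n)%N ->
    `|\int[mu]_(s in `[0, m%:R * h]) f s - h * \sum_(k < m) f (k%:R * h)|
    <= m%:R * h * e by exact: H.
elim: m => [_|m IH mn].
  rewrite big_ord0 mulr0 subr0 mul0r mul0r (_ : [set` _] = [set 0]).
    by rewrite Rintegral_set1 normr0.
  by rewrite set_itv1.
have mh k : (k <= n)%N -> 0 <= k%:R * h <= n%:R * h.
  by move=> kn; rewrite mulr_ge0//= ler_wpM2r// ler_nat.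
have mS : m.+1%:R * h = m%:R * h + h by rewrite -natr1 mulrDl mul1r.
have /andP[m0 mn'] := mh m (ltnW mn); have /andP[_ mSn] := mh _ mn.
have mm : m%:R * h <= m.+1%:R * h by rewrite mS lerDl.
have := @Rintegral_increment_le f _ _ (f (m%:R * h)) e _ cf m0 mm mSn.
have -> : m.+1%:R * h - m%:R * h = h by rewrite mS addrAC subrr add0r.
have fm s : m%:R * h <= s <= m.+1%:R * h -> `|f s - f (m%:R * h)| <= e.
  move=> /andP[ms sm]; apply: fe.
  - by rewrite (le_trans m0 ms)/= (le_trans sm).
  - by rewrite m0.
  - by rewrite ger0_norm ?subr_ge0// lerBlDl -mS.
move=> /(_ fm) step; have := IH (ltnW mn).
rewrite big_ord_recr/= => IHm.
set I1 := \int[mu]_(s in `[0, m.+1%:R * h]) f s in step *.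
set I0 := \int[mu]_(s in `[0, m%:R * h]) f s in step IHm *.
rewrite [X in `|X|](_ : _ = (I0 - h * \sum_(k < m) f (k%:R * h)) +
  (I1 - I0 - h * f (m%:R * h))); last by ring.
rewrite (le_trans (ler_normD _ _))// mS mulrDl lerD//.
Qed.

End path_analysis.

(** * Convergence of the two schemes along a fixed path *)

Section discretized_paths.
Context {R : realType}.
Local Notation mu := (@lebesgue_measure R).
Local Notation RT := (measurableTypeR R).
Implicit Types (b x W : R -> R) (h t : R).

Lemma near_mesh_lt t d : 0 < d -> \forall n \near \oo, t / n.+1%:R < d.
Proof.
move=> d0; have [t0|t0] := leP t 0.
  by apply: nearW => n; rewrite (le_lt_trans _ d0)// mulr_le0_ge0.
have dt : 0 < d / t by rewrite divr_gt0.
have := near_infty_natSinv_lt (PosNum dt); apply: filterS => n /=.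
by rewrite ltr_pdivlMr// mulrC.
Qed.

(** The recursion is exact for left Riemann sums: if [D] is the denominator at time [n] and
    [g = E / D], then [1 + beta h g] is the ratio of the next denominator to [D], so the
    denominators telescope. *)
Lemma Gamma_chainE d (T' : measurableType d) (Z : nat -> T' -> RT) (w : T')
    (beta h : R) b n :
  0 <= beta -> 0 <= h -> b 0 = 0 ->
  (forall k, Z k w = b (k.+1%:R * h) - b (k%:R * h)) ->
  rec_chain Z (Gamma_step beta h) 1 n w =
  expR (b (n%:R * h) - n%:R * h / 2) /
  (1 + beta * (h * \sum_(k < n) expR (b (k%:R * h) - k%:R * h / 2))).
Proof.
move=> beta0 h0 b0 ZE; elim: n => [|n IH] /=.
  by rewrite big_ord0 !mul0r b0 subr0 expR0 !mulr0 addr0 divr1.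
rewrite {}IH /Gamma_step/= ZE big_ord_recr/=.
set S := \sum_(_ < n) _; set E := expR (b (n%:R * h) - _).
have S0 : 0 <= S by apply: sumr_ge0 => i _; exact: expR_ge0.
have E0 : 0 < E by exact: expR_gt0.
have -> : expR (b (n.+1%:R * h) - n.+1%:R * h / 2) =
    E * expR (b (n.+1%:R * h) - b (n%:R * h) - h / 2).
  by rewrite -expRD -natr1; congr expR; ring.
have D0 : 0 < 1 + beta * (h * S) by rewrite ltr_pwDl// !mulr_ge0.
have D1 : 0 < 1 + beta * (h * (S + E)).
  by rewrite ltr_pwDl// !mulr_ge0// addr_ge0// ltW.
by field; rewrite !gt_eqF.
Qed.

Lemma Gamma_chain_cvg d (T' : measurableType d) (B : R -> T' -> R) (w : T')
    (beta t : R) :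
  0 < beta -> 0 < t -> B 0 w = 0 ->
  {within [set s | 0 <= s], continuous (fun s => B s w)} ->
  (fun n => rec_chain
     (fun k w => B (k.+1%:R * (t / n.+1%:R)) w - B (k%:R * (t / n.+1%:R)) w : RT)
     (Gamma_step beta (t / n.+1%:R)) 1 n.+1 w : R) @ \oo --> Gamma_proc beta B t w.
Proof.
move=> beta0 t0 B0 cB.
pose f s := expR (B s w - s / 2).
have cB' := within_continuous_segment (t := t) cB.
have cf : {within `[0, t], continuous f}.
  apply/subspace_continuousP => s st; apply: (cvg_comp _ expR); last exact: continuous_expR.
  apply: cvgB; first by move/subspace_continuousP : cB'; apply.
  apply: cvgM; last exact: cvg_cst.
  exact: cvg_within.
pose I := \int[mu]_(s in `[0, t]) f s.
have I0 : 0 <= I by apply: Rintegral_ge0 => s _; exact: expR_ge0.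
have nt n : n.+1%:R * (t / n.+1%:R) = t by rewrite mulrC divfK.
have hn0 n : 0 < t / n.+1%:R by rewrite divr_gt0.
have Scvg : (fun n => (t / n.+1%:R) *
    \sum_(k < n.+1) f (k%:R * (t / n.+1%:R))) @ \oo --> I.
  apply/cvgrPdist_le => e e0.
  have et0 : 0 < e / t by rewrite divr_gt0.
  have [dl dl0 dlP] := within_continuous_uniform cf et0.
  have := near_mesh_lt t dl0; apply: filterS => n hn.
  have := @Riemann_sum_le R f (t / n.+1%:R) (e / t) n.+1 (ltW (hn0 n)).
  have te : t * (e / t) = e by rewrite mulrC divfK// gt_eqF.
  rewrite nt te; apply => // s r st rt sr.
  by apply/ltW/dlP => //; exact: le_lt_trans hn.
rewrite (_ : (fun n => _) = (fun n => f t / (1 + beta * ((t / n.+1%:R) *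
    \sum_(k < n.+1) f (k%:R * (t / n.+1%:R)))))); last first.
  apply/funext => n.
  rewrite (@Gamma_chainE _ _ _ _ _ _ (fun s => B s w))//; [|exact: ltW|exact: ltW].
  by rewrite nt.
rewrite /Gamma_proc -/(f t).
have -> : fine (\int[mu]_(s in `[0%R, t]) (expR (B s w - s / 2))%:E)%E = I by [].
have D0 : 1 + beta * I != 0 by rewrite gt_eqF// ltr_pwDl// mulr_ge0// ltW.
apply: cvgM; first exact: cvg_cst.
apply: cvgV => //; apply: cvgD; first exact: cvg_cst.
by apply: cvgM; first exact: cvg_cst.
Qed.

(** In the variable [expR (- (2 * x0))], which stays away from 1 when [x0] stays away from 0, [coth]
    is a fractional linear function; its Lipschitz constant can then be read off without
    differentiating. *)
Lemma cothRE (x0 : R) : 0 < x0 ->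
  cothR x0 / 2 = (1 + expR (- (2 * x0))) / (1 - expR (- (2 * x0))) / 2 :> R.
Proof.
move=> x00; rewrite /cothR /coshR /sinhR; set e := expR x0.
have e1 : 1 < e by rewrite /e -expR0 ltr_expR.
have -> : expR (- x0) = e^-1 by rewrite expRN.
have -> : expR (- (2 * x0)) = (e ^+ 2)^-1 by rewrite expRN expRM_natl.
have n1 : e ^+ 2 - 1 != 0 by rewrite subr_eq0 gt_eqF// exprn_egt1.
have n2 : e - e^-1 != 0 by rewrite subr_eq0 gt_eqF// (lt_trans _ e1)// invf_lt1// (lt_trans ltr01).
have n3 : e != 0 by rewrite gt_eqF// (lt_trans ltr01).
by field; rewrite n1 n3.
Qed.

Lemma cothR_lipschitz (a : R) : 0 < a -> exists2 L, 0 <= L &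
  forall y z, a <= y -> a <= z -> `|cothR y / 2 - cothR z / 2| <= L * `|y - z|.
Proof.
move=> a0; set q := expR (- (2 * a)).
have q1 : q < 1 by rewrite expR_lt1 oppr_lt0 mulr_gt0.
have q0 : 0 < 1 - q by rewrite subr_gt0.
exists (2 / (1 - q) ^+ 2); first by rewrite divr_ge0// sqr_ge0.
suff H y z : a <= y -> y <= z ->
    `|cothR y / 2 - cothR z / 2| <= 2 / (1 - q) ^+ 2 * `|y - z|.
  move=> y z ay az; have [yz|zy] := leP y z; first exact: H.
  by rewrite distrC [`|y - z|]distrC; apply: H => //; exact: ltW.
move=> ay yz; have y0 : 0 < y by exact: lt_le_trans ay.
have z0 : 0 < z by exact: lt_le_trans yz.
rewrite !cothRE//; set u := expR (- (2 * y)); set v := expR (- (2 * z)).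
have uq : u <= q by rewrite ler_expR lerN2 ler_pM2l.
have vu : v <= u by rewrite ler_expR lerN2 ler_pM2l.
have v0 : 0 < v by exact: expR_gt0.
have u1 : 0 < 1 - u by lra.
have v1 : 0 < 1 - v by lra.
have uv : u - v <= 2 * (z - y).
  have -> : v = u * expR (- (2 * (z - y))) by rewrite -expRD; congr expR; ring.
  have := expR_ge1Dx (- (2 * (z - y))); set E := expR _ => E1.
  have u0 : 0 < u by exact: expR_gt0.
  have uu1 : u <= 1 by lra.
  have zy0 : 0 <= z - y by lra.
  have : u * (1 - E) <= u * (2 * (z - y)) by rewrite ler_wpM2l ?(ltW u0)//; lra.
  have : u * (2 * (z - y)) <= 1 * (2 * (z - y)) by rewrite ler_wpM2r//; lra.
  lra.
rewrite [X in `|X|](_ : _ = (u - v) / ((1 - u) * (1 - v))); last first.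
  by field; rewrite !gt_eqF.
rewrite ger0_norm; last by rewrite divr_ge0 ?subr_ge0// mulr_ge0// ltW.
rewrite distrC (@ger0_norm _ (z - y)) ?subr_ge0// mulrAC.
apply: ler_pM; rewrite ?subr_ge0// ?invr_ge0 ?mulr_ge0// ?(ltW u1) ?(ltW v1)//.
rewrite lef_pV2 ?posrE ?exprn_gt0 ?mulr_gt0// expr2.
by apply: ler_pM; lra.
Qed.

(** The increment of [W] is the same in the path and in the scheme and cancels. Only the drift
    contributes, so the error obeys [E' <= E + h L (om + E)], where [om] bounds the oscillation of
    [x] over one cell; the bound solves this recursion. *)
Lemma Euler_tracking d (T' : measurableType d) (Z : nat -> T' -> RT) (w : T')
    x W (h eps L om : R) n m :
  0 < h -> 0 < eps -> 0 <= L -> 0 <= om ->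
  (forall y z, eps / 2 <= y -> eps / 2 <= z ->
     `|cothR y / 2 - cothR z / 2| <= L * `|y - z|) ->
  (forall k, Z k w = W (k.+1%:R * h) - W (k%:R * h)) ->
  W 0 = 0 ->
  {within `[0, n%:R * h], continuous x} ->
  (forall s, 0 <= s <= n%:R * h -> 0 <= x s) ->
  (forall s, 0 <= s -> (forall r, 0 <= r <= s -> 0 < x r) ->
     x s = x 0 + W s + \int[mu]_(r in `[0, s]) ((- 1 + 2^-1) * cothR (x r))) ->
  (forall s r, 0 <= s <= n%:R * h -> 0 <= r <= n%:R * h -> `|s - r| <= h ->
     `|x s - x r| <= om) ->
  (m <= n)%N ->
  (forall s, 0 <= s <= m%:R * h -> eps / 2 <= x s) ->
  (forall k, (k < m)%N -> eps < rec_chain Z (Euler_step eps h) (x 0) k w) ->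
  `|rec_chain Z (Euler_step eps h) (x 0) m w - x (m%:R * h)|
  <= om * ((1 + h * L) ^+ m - 1).
Proof.
move=> h0 eps0 L0 om0 LP ZE W0 cx x_ge0 xE xom.
elim: m => [_ _ _|m IH mn xeps Xeps].
  by rewrite /= mul0r subrr normr0 expr0 subrr mulr0.
have mS : m.+1%:R * h = m%:R * h + h by rewrite -natr1 mulrDl mul1r.
have mh0 : 0 <= m%:R * h by rewrite mulr_ge0// ltW.
have mh : m%:R * h <= m.+1%:R * h by rewrite mS lerDl ltW.
have mhn : m.+1%:R * h <= n%:R * h by rewrite ler_wpM2r ?(ltW h0)// ler_nat.
have IHm : `|rec_chain Z (Euler_step eps h) (x 0) m w - x (m%:R * h)|
    <= om * ((1 + h * L) ^+ m - 1).
  apply: IH; first exact: ltnW.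
  - by move=> s /andP[s0 sm]; apply: xeps; rewrite s0 (le_trans sm).
  - by move=> k km; apply: Xeps; exact: ltnW.
have Xm := Xeps m (ltnSn m).
rewrite [rec_chain _ _ _ m.+1 _]/= /Euler_step/= Xm.
set X := rec_chain _ _ _ m w in IHm Xm *.
have xm1 : 0 <= x (m.+1%:R * h) by apply: x_ge0; rewrite mhn (le_trans mh0).
(* The reflection does no harm: [x] is nonnegative and the absolute value is 1-Lipschitz. *)
rewrite -(ger0_norm xm1); apply: (le_trans (ler_dist_dist _ _)).
pose f r := (- 1 + 2^-1) * cothR (x r).
have fE r : f r = - (cothR (x r) / 2) by rewrite /f; field.
have cf : {within `[0, m.+1%:R * h], continuous f}.
  apply: (within_continuous_dominated L0 (within_continuous_le mhn cx)) => r s.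
  rewrite /= !in_itv/= => rm sm; rewrite !fE -opprD normrN.
  by apply: LP; exact: xeps.
have e20 : 0 < eps / 2 by rewrite divr_gt0.
have xpos s : 0 <= s <= m.+1%:R * h -> 0 < x s.
  by move=> sm; apply: lt_le_trans e20 _; exact: xeps.
have xmE : x (m%:R * h) = x 0 + W (m%:R * h) + \int[mu]_(r in `[0, m%:R * h]) f r.
  apply: xE => // r /andP[r0 rm]; apply: xpos; rewrite r0; exact: le_trans mh.
have xSE : x (m.+1%:R * h) =
    x 0 + W (m.+1%:R * h) + \int[mu]_(r in `[0, m.+1%:R * h]) f r.
  by apply: xE => // ; exact: le_trans mh.
set E := om * ((1 + h * L) ^+ m - 1) in IHm *.
have fX s : m%:R * h <= s <= m.+1%:R * h -> `|f s - - (cothR X / 2)| <= L * (om + E).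
  move=> /andP[ms sm]; rewrite fE -opprD normrN.
  have s0 : 0 <= s by exact: le_trans ms.
  have eX : eps / 2 <= X by rewrite ltW// (le_lt_trans _ Xm)// ler_pdivrMr// ler_peMr// ?ler1n// ltW.
  apply: (le_trans (LP _ _ (xeps s _) eX)); first by rewrite s0.
  rewrite ler_wpM2l// (le_trans (ler_distD (x (m%:R * h)) _ _))// lerD//.
    apply: xom; [by rewrite s0 (le_trans sm)|by rewrite mh0 (le_trans mh)|].
    by rewrite ger0_norm ?subr_ge0// lerBlDl -mS.
  by rewrite distrC.
have := Rintegral_increment_le cf mh0 mh (lexx _) fX.
have -> : m.+1%:R * h - m%:R * h = h by rewrite mS addrAC subrr add0r.
set I1 := \int[mu]_(r in `[0, m.+1%:R * h]) f r in xSE *.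
set I0 := \int[mu]_(r in `[0, m%:R * h]) f r in xmE *.
move=> step.
rewrite ZE [X in `|X|](_ : _ = (X - x (m%:R * h)) -
    (I1 - I0 - h * - (cothR X / 2))); last by rewrite xSE xmE; ring.
rewrite (le_trans (ler_normB _ _))// (le_trans (lerD IHm step))//.
by rewrite /E exprS le_eqVlt; apply/orP; left; apply/eqP; ring.
Qed.

End discretized_paths.

Section Euler_convergence.
Context {R : realType} d (T : measurableType d).
Local Notation mu := (@lebesgue_measure R).
Local Notation RT := (measurableTypeR R).

Lemma Euler_stopped (Z : nat -> T -> RT) (eps h y : R) (w : T) k j :
  rec_chain Z (Euler_step eps h) y k w <= eps ->
  rec_chain Z (Euler_step eps h) y (k + j) w = rec_chain Z (Euler_step eps h) y k w.
Proof.
move=> Xk; elim: j => [|j IH]; first by rewrite addn0.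
by rewrite addnS /= {1}/Euler_step/= IH ltNge Xk.
Qed.

(** The index stays at most [K] although [s] may reach [K.+1] cells. This matters when [K.+1] is the
    first grid time at which the path is low, since only the earlier grid points are known to be
    high. *)
Lemma grid_near (h s : R) K : 0 <= h -> 0 <= s <= K.+1%:R * h ->
  exists2 k, (k <= K)%N & `|s - k%:R * h| <= h.
Proof.
move=> h0; elim: K => [|K IH] /andP[s0 sK].
  by exists 0%N => //; rewrite mul0r subr0 ger0_norm// -[leRHS]mul1r.
have [sK1|sK1] := leP s (K.+1%:R * h).
  have [|k kK ks] := IH; first by rewrite s0.
  by exists k => //; exact: leq_trans kK _.
exists K.+1 => //; rewrite ger0_norm ?subr_ge0 ?(ltW sK1)//.
by rewrite lerBlDl; move: sK; rewrite -[K.+2%:R]natr1 mulrDl mul1r.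
Qed.

Lemma continuous_expN_potential (beta y : R) :
  {for y, continuous (fun y => expR (- bessel_potential beta y))}.
Proof.
rewrite /bessel_potential /coshR.
apply: (@continuous_comp _ _ _ (fun y => - (beta * ((expR y + expR (- y)) / 2 - 1))) expR);
  last exact: continuous_expR.
apply: cvgN; apply: cvgM; first exact: cvg_cst.
apply: cvgB; last exact: cvg_cst.
apply: cvgM; last exact: cvg_cst.
apply: cvgD; first exact: continuous_expR.
apply: (@continuous_comp _ _ _ -%R expR); last exact: continuous_expR.
exact: opp_continuous.
Qed.

(** If [X t = 0], a chain not frozen by time [t] would still track the path after its descent below
    [eps], which is impossible on a fine mesh; the payoff is then eventually 1, its limit. If
    [X t > 0], absorption makes the path positive on all of [[0, t]], and for [eps] at most half its
    minimum the chain is never frozen on a fine mesh. The threshold [e1] depends on the path. *)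
Lemma Euler_payoff_cvg (X W : R -> T -> R) (w : T) (beta t : R) :
  0 < beta -> 0 < t -> W 0 w = 0 ->
  {within [set s | 0 <= s], continuous (fun s => X s w)} ->
  (forall s, 0 <= s -> 0 <= X s w) ->
  (forall s r, 0 <= s -> s <= r -> X s w = 0 -> X r w = 0) ->
  (forall s, 0 <= s -> (forall r, 0 <= r <= s -> 0 < X r w) ->
     X s w = X 0 w + W s w +
       \int[mu]_(r in `[0, s]) ((- 1 + 2^-1) * cothR (X r w))) ->
  exists2 e1, 0 < e1 & forall eps, 0 < eps -> eps <= e1 ->
  (fun n => stopped_payoff beta eps (rec_chain
     (fun k w => W (k.+1%:R * (t / n.+1%:R)) w - W (k%:R * (t / n.+1%:R)) w : RT)
     (Euler_step eps (t / n.+1%:R)) (X 0 w) n.+1 w)) @ \oo -->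
  expR (- bessel_potential beta (X t w)).
Proof.
move=> beta0 t0 W0 cX X0 Xabs XE.
have cXt := within_continuous_segment (t := t) cX.
have nt n : n.+1%:R * (t / n.+1%:R) = t by rewrite mulrC divfK.
have hn0 n : 0 < t / n.+1%:R by rewrite divr_gt0.
pose x s := X s w.
pose Y eps n := rec_chain
     (fun k w => W (k.+1%:R * (t / n.+1%:R)) w - W (k%:R * (t / n.+1%:R)) w : RT)
     (Euler_step eps (t / n.+1%:R)) (X 0 w).
(* [Kc = expR (L * t)] dominates the growth factor [(1 + h L) ^ m] for all meshes at once, so an
   oscillation [om'] with [om' * Kc <= om] gives a tracking error at most [om]. *)
have track eps om : 0 < eps -> 0 < om -> exists2 Kc, 1 <= Kc &
    (forall om', 0 < om' -> om' * Kc <= om -> \forall n \near \oo,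
      (forall s r, 0 <= s <= t -> 0 <= r <= t -> `|s - r| <= t / n.+1%:R ->
         `|x s - x r| <= om') /\
      forall m, (m <= n.+1)%N ->
        (forall s, 0 <= s <= m%:R * (t / n.+1%:R) -> eps / 2 <= x s) ->
        (forall k, (k < m)%N -> eps < Y eps n k w) ->
        `|Y eps n m w - x (m%:R * (t / n.+1%:R))| <= om).
  move=> eps0 om0; have e20 : 0 < eps / 2 by rewrite divr_gt0.
  have [L L0 LP] := cothR_lipschitz e20.
  exists (expR (L * t)); first by rewrite -expR0 ler_expR mulr_ge0// ltW.
  move=> om' om'0 om'K; have [dl dl0 dlP] := within_continuous_uniform cXt om'0.
  have := near_mesh_lt t dl0; apply: filterS => n hn.
  have modx s r : 0 <= s <= t -> 0 <= r <= t -> `|s - r| <= t / n.+1%:R ->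
      `|x s - x r| <= om'.
    by move=> st rt sr; apply/ltW/dlP => //; exact: le_lt_trans hn.
  split => // m mn xe Ye.
  have cXn : {within `[0, n.+1%:R * (t / n.+1%:R)], continuous x} by rewrite nt.
  have T1 := @Euler_tracking R _ _
    (fun k w => W (k.+1%:R * (t / n.+1%:R)) w - W (k%:R * (t / n.+1%:R)) w : RT)
    w x (fun s => W s w) _ eps L om' n.+1 m (hn0 n) eps0 L0 (ltW om'0) LP
    (fun k => erefl) W0 cXn.
  rewrite nt in T1.
  apply: (le_trans (T1 _ XE modx mn xe Ye)); first by move=> s /andP[s0 _]; exact: X0.
  apply: le_trans om'K; rewrite ler_wpM2l ?(ltW om'0)//.
  apply: (@le_trans _ _ ((1 + t / n.+1%:R * L) ^+ m)); first by rewrite gerBl.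
  apply: (@le_trans _ _ (expR (t / n.+1%:R * L) ^+ m)).
    rewrite lerXn2r ?nnegrE ?expR_ge0 ?expR_ge1Dx//.
    by rewrite addr_ge0// mulr_ge0// ltW.
  rewrite -expRM_natl ler_expR mulrA mulrC ler_wpM2l//.
  by rewrite -[leRHS](nt n) ler_wpM2r ?(ltW (hn0 n))// ler_nat.
have [xt0|xt0] := eqVneq (x t) 0.
  exists 1 => // eps eps0 _.
  have om0 : 0 < eps / 8 by rewrite divr_gt0.
  have [Kc Kc1 KcP] := track eps _ eps0 om0.
  have Kc0 : 0 < Kc by exact: lt_le_trans Kc1.
  have om'0 : 0 < eps / 8 / Kc by rewrite divr_gt0.
  have om'le : eps / 8 / Kc * Kc <= eps / 8 by rewrite divfK// gt_eqF.
  have om'8 : eps / 8 / Kc <= eps / 8 by rewrite ler_pdivrMr// ler_peMr// ltW.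
  have -> : expR (- bessel_potential beta (X t w)) = 1.
    rewrite -/(x t) xt0 /bessel_potential /coshR oppr0 expR0.
    by rewrite (_ : (1 + 1) / 2 - 1 = 0) ?mulr0 ?oppr0 ?expR0//; field.
  apply: cvg_near_cst; have := KcP _ om'0 om'le; apply: filterS => n [modx trk].
  rewrite /stopped_payoff -/(Y eps n); case: ifPn => // Yn; exfalso.
  have Yk k : (k <= n.+1)%N -> eps < Y eps n k w.
    move=> kn; rewrite ltNge; apply/negP => Yle; move: Yn; apply/negP.
    by rewrite -leNgt -(subnKC kn) /Y Euler_stopped.
  set h := t / n.+1%:R in modx trk *.
  have h0 : 0 < h by exact: hn0.
  (* The level [3/4 eps] leaves room [eps / 8] on both sides. Up to the first grid time [K] below
     it, the path stays above [3/4 eps - eps / 8 >= eps / 2], so tracking is valid; at [K] the chain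
     is at most [3/4 eps + eps / 8 < eps], hence frozen. *)
  have ex : exists k, x (k%:R * h) <= 3 / 4 * eps.
    by exists n.+1; rewrite nt xt0 mulr_ge0// ltW.
  have kt k : (k <= n.+1)%N -> 0 <= k%:R * h <= t.
    move=> kn; rewrite mulr_ge0 ?(ltW h0)//= -[leRHS](nt n).
    by rewrite ler_wpM2r ?(ltW h0)// ler_nat.
  case: (ex_minnP ex) => K xK Kmin.
  have Kn : (K <= n.+1)%N by apply: Kmin; rewrite nt xt0 mulr_ge0// ltW.
  have YK := Yk K Kn.
  (* For [K = 0] there is no tracking to invoke: the chain starts on the path itself. *)
  case: K xK Kmin Kn YK => [|K] xK Kmin Kn YK.
    by move: YK; rewrite /Y/= ltNge => /negP; apply; move: xK; rewrite mul0r -/(x 0); lra.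
  have xs s : 0 <= s <= K.+1%:R * h -> eps / 2 <= x s.
    move=> sK; have [k kK sk] := grid_near (ltW h0) sK.
    have xk : 3 / 4 * eps < x (k%:R * h).
      by rewrite ltNge; apply/negP => /Kmin; rewrite ltnNge kK.
    have /andP[s0 sK'] := sK; have /andP[_ Kt] := kt _ Kn.
    have st : 0 <= s <= t by rewrite s0 (le_trans sK').
    have [|m1 _] := ler_normlW2 (modx s (k%:R * h) st _ sk).
      by apply: kt; rewrite (leq_trans kK)// ltnW.
    by clear -xk m1 om'8 eps0; lra.
  have [_ m2] := ler_normlW2
    (trk _ Kn xs (fun k kK => Yk k (leq_trans (ltnW kK) Kn))).
  by clear -YK m2 xK eps0; lra.
have xt_gt0 : 0 < x t by rewrite lt_neqAle eq_sym xt0 X0// ltW.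
(* The minimum over [[0, t]] is positive, since a zero before [t] would persist until [t]. *)
have [c] := EVT_min (ltW t0) cXt; rewrite in_itv/= => ct cmin.
have xc : 0 < x c.
  have /andP[c0 ct'] := ct; rewrite lt_neqAle X0// andbT eq_sym.
  by apply: contra xt0 => /eqP xc0; rewrite /x (Xabs c t).
exists (x c / 2); first by rewrite divr_gt0.
move=> eps eps0 epsc.
apply/cvgrPdist_lt => e e0.
have /cvgrPdist_lt /(_ e e0) [dl /= dl0 dlP] := @continuous_expN_potential beta (x t).
pose om := Num.min eps dl / 2.
have om0 : 0 < om by rewrite divr_gt0// lt_min eps0.
have omeps : om < eps.
  by rewrite /om ltr_pdivrMr// (@le_lt_trans _ _ eps)// ?ge_min ?lexx//
    ltr_pMr// ltr1n.
have omdl : om < dl.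
  by rewrite /om ltr_pdivrMr// (@le_lt_trans _ _ dl)// ?ge_min ?lexx ?orbT//
    ltr_pMr// ltr1n.
have [Kc Kc1 KcP] := track eps _ eps0 om0.
have Kc0 : 0 < Kc by exact: lt_le_trans Kc1.
have om'0 : 0 < om / Kc by rewrite divr_gt0.
have om'le : om / Kc * Kc <= om by rewrite divfK// gt_eqF.
have := KcP _ om'0 om'le; apply: filterS => n [modx trk].
set h := t / n.+1%:R in modx trk.
have h0 : 0 < h by exact: hn0.
have xs k s : (k <= n.+1)%N -> 0 <= s <= k%:R * h -> 2 * eps <= x s.
  move=> kn /andP[s0 sk]; apply: (@le_trans _ _ (x c)); first by clear -epsc; lra.
  apply: cmin; rewrite in_itv/= s0 (le_trans sk)// -[leRHS](nt n).
  by rewrite ler_wpM2r ?(ltW h0)// ler_nat.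
have trk' k : (k <= n.+1)%N -> (forall j, (j < k)%N -> eps < Y eps n j w) ->
    `|Y eps n k w - x (k%:R * h)| <= om.
  move=> kn Yj; apply: trk => // s /(xs k s kn) xs2.
  by clear -xs2 eps0; lra.
(* Bootstrap: not being frozen before [k] gives tracking at [k], and since the path is above [2 eps]
   and [om < eps], the chain is not frozen at [k] either. *)
have Yk k : (k <= n.+1)%N -> forall j, (j < k)%N -> eps < Y eps n j w.
  elim: k => // k IH kn j; rewrite ltnS leq_eqVlt => /predU1P[->|]; last first.
    by apply: IH; exact: ltnW.
  have [m1 _] := ler_normlW2 (trk' k (ltnW kn) (IH (ltnW kn))).
  have : 2 * eps <= x (k%:R * h).
    by apply: (xs k _ (ltnW kn)); rewrite lexx andbT mulr_ge0// ltW.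
  by clear -m1 omeps; lra.
have Yn := trk' _ (leqnn _) (Yk _ (leqnn _)); rewrite nt in Yn.
have Ygt : eps < Y eps n n.+1 w.
  have [m1 _] := ler_normlW2 Yn.
  have : 2 * eps <= x t.
    by apply: (xs n.+1 _ (leqnn _)); rewrite nt lexx andbT ltW.
  by clear -m1 omeps; lra.
rewrite /stopped_payoff -/(Y eps n) Ygt; apply: dlP => /=.
by rewrite distrC (le_lt_trans Yn).
Qed.

End Euler_convergence.

(** * Passage to the limit *)

Section lower_integral.
Local Open Scope ereal_scope.
Context d (T : measurableType d) {R : realType}.
Variable mu : {measure set T -> \bar R}.

Import HBNNSimple.

(* The integral of a nonnegative function is a supremum over simple minorants,
   hence insensitive to the values on a null set even if [f] is not measurable. *)
Lemma ge0_integral_restrict_null (N : set T) (f : T -> \bar R) :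
  measurable N -> mu N = 0 -> (forall x, 0 <= f x) ->
  measurable_fun setT (f \_ (~` N)) ->
  \int[mu]_x f x = \int[mu]_x (f \_ (~` N)) x.
Proof.
move=> mN N0 f0 mg; set g := f \_ (~` N).
have g0 x : 0 <= g x by exact: erestrict_ge0.
have gf x : g x <= f x by rewrite /g patchE; case: ifPn.
apply/eqP; rewrite eq_le; apply/andP; split; last first.
  rewrite [leLHS]ge0_integralTE// [leRHS]ge0_integralTE//.
  apply: ereal_sup_le => _ [h /= hg <-].
  by exists h => //= x; exact: le_trans (gf x).
rewrite [leLHS]ge0_integralTE//.
apply: ge_ereal_sup => _ [h /= hf <-].
rewrite -integralT_nnsfun.
have mh : measurable_fun setT (EFin \o h) by apply/measurable_EFinP.
have mCN : measurable (~` N) by exact: measurableC.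
have mhN : measurable_fun setT ((EFin \o h) \_ (~` N)).
  by apply/(measurable_restrictT _ mCN); exact: measurable_funTS.
have -> : \int[mu]_x (h x)%:E = \int[mu]_x (((EFin \o h) \_ (~` N)) x).
  apply: ae_eq_integral => //.
  exists N; split => // x /= /not_implyP[_]; apply: contra_notP => nNx.
  by rewrite patchE ifT// inE.
apply: ge0_le_integral => //.
- by move=> x _; apply: erestrict_ge0 => y _; rewrite lee_fin.
- by move=> x _; rewrite /g !patchE; case: ifPn => // _; exact: hf.
Qed.

End lower_integral.

Section iterated_limit.
Local Open Scope ereal_scope.
Context {R : realType}.

Lemma limn_einf_gt (u : (\bar R)^nat) (c : \bar R) : c < limn_einf u ->
  \forall n \near \oo, c < u n.
Proof.
rewrite limn_einf_lim (cvg_lim _ (@cvg_einfs_sup _ u))// => /ereal_sup_gt[_ [N _ <-] cN].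
exists N => // n /= Nn; apply: lt_le_trans cN _.
by apply: ereal_inf_lbound; exists n.
Qed.

Context d (T : measurableType d) (P : probability T R).

Lemma integral_iterated_limit0 (f : nat -> nat -> T -> R) :
  (forall j n, measurable_fun setT (f j n)) ->
  (forall j n w, (0 <= f j n w <= 1)%R) ->
  {ae P, forall w, \forall j \near \oo, f j n w @[n --> \oo] --> (0 : R)%R} ->
  forall e : R, (0 < e)%R -> \forall j \near \oo, \forall n \near \oo,
    \int[P]_w (f j n w)%:E < e%:E.
Proof.
move=> mf f01 fae e e0.
pose F j n w := (1 - f j n w)%R%:E.
have mF j n : measurable_fun setT (F j n).
  by apply/measurable_EFinP; exact: measurable_funB.
have F0 j n w : 0 <= F j n w.
  by rewrite lee_fin subr_ge0; have /andP[] := f01 j n w.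
pose G j w := limn_einf (F j ^~ w).
have mG j : measurable_fun setT (G j).
  rewrite (_ : G j = (fun w => - limn_esup (\- (F j ^~ w)))) //.
  apply: (measurableT_comp (@oppe_measurable R setT)).
  apply: measurable_fun_limn_esup => n.
  exact: (measurableT_comp (@oppe_measurable R setT)).
have G0 j w : 0 <= G j w.
  rewrite /G limn_einf_lim; apply: lime_ge; first exact: is_cvg_einfs.
  by apply: nearW => n; apply: le_ereal_inf_tmp => _ [m _ <-].
have G1 : \int[P]_w limn_einf (G ^~ w) = 1.
  rewrite -[RHS](integral_probability_cst P).
  apply: ae_eq_integral => //.
    rewrite (_ : (fun w => _) = (fun w => - limn_esup (\- (G ^~ w)))) //.
    apply: (measurableT_comp (@oppe_measurable R setT)).
  apply: measurable_fun_limn_esup => n.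
    exact: (measurableT_comp (@oppe_measurable R setT)).
  apply: filterS fae => w fw _.
  have [-> _] // : limn_einf (G ^~ w) = 1 /\ limn_esup (G ^~ w) = 1.
  have Gc : G ^~ w @ \oo --> (1 : \bar R).
    apply: cvg_near_cst; apply: filterS fw => j fj.
    have Fc : F j ^~ w @ \oo --> (1 : \bar R).
      apply: cvg_EFin; first exact: nearW.
      rewrite -[X in _ --> X](subr0 1%R); apply: cvgB => //; exact: cvg_cst.
    by have [] := cvg_limn_einf_sup Fc.
  by have [] := cvg_limn_einf_sup Gc.
have GF j : \int[P]_w G j w <= limn_einf (fun n => \int[P]_w F j n w).
  by apply: fatou => // n.
have GG : 1 <= limn_einf (fun j => \int[P]_w G j w).
  by rewrite -G1; apply: fatou.
have e1 : (1 - e)%:E < limn_einf (fun j => \int[P]_w G j w).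
  by apply: lt_le_trans GG; rewrite lte_fin ltrBlDr ltrDl.
have := limn_einf_gt e1; apply: filterS => j Gj.
have := limn_einf_gt (lt_le_trans Gj (GF j)); apply: filterS => n Fn.
have : \int[P]_w (f j n w)%:E + \int[P]_w F j n w = 1.
  rewrite -ge0_integralD//; last 2 first.
  - by move=> w _; rewrite lee_fin; have /andP[] := f01 j n w.
  - exact/measurable_EFinP.
  under eq_integral do rewrite -EFinD addrC subrK.
  exact: integral_probability_cst.
move: Fn; case: (\int[P]_w F j n w) => [r| |]; case: (\int[P]_w _) => [s| |] //=.
by rewrite !lte_fin => rs [] sr; rewrite -(ltrD2r r) sr addrC -ltrBlDr.
Qed.

End iterated_limit.

Section hyperbolic_inverse.
Context {R : realType}.
Implicit Types x y c : R.

Lemma coshR_surj c : 1 <= c -> exists2 x, 0 <= x & coshR x = c.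
Proof.
move=> c1; set s := Num.sqrt (c ^+ 2 - 1).
have s0 : 0 <= s by exact: sqrtr_ge0.
have s2 : s ^+ 2 = c ^+ 2 - 1.
  by rewrite sqr_sqrtr// subr_ge0 expr_ge1// (le_trans ler01).
have r1 : 1 <= c + s by lra.
have r0 : 0 < c + s by lra.
(* The inverse hyperbolic cosine, [ln (c + sqrt (c ^ 2 - 1))]. *)
exists (ln (c + s)); first exact: ln_ge0.
rewrite /coshR expRN lnK ?posrE//.
have -> : (c + s)^-1 = c - s.
  apply: (mulfI (lt0r_neq0 r0)); rewrite divff ?gt_eqF//.
  by rewrite mulrC -subr_sqr s2; ring.
by field.
Qed.

Lemma coshR_inj_ge0 x y : 0 <= x -> 0 <= y -> coshR x = coshR y -> x = y.
Proof.
wlog xy : x y / x <= y.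
  move=> H x0 y0 xy; have [xy'|yx] := leP x y; first exact: H.
  by apply/esym/H => //; exact: ltW.
move=> x0 y0 cxy; apply/eqP; rewrite eq_le xy/= leNgt; apply/negP => yx.
suff : coshR x < coshR y by rewrite cxy ltxx.
have y1 : 0 < y by exact: le_lt_trans yx.
rewrite /coshR ltr_pM2r//.
have h1 : expR x < expR y by rewrite ltr_expR.
have h2 : expR x * expR (- x) = 1 by exact: expRxMexpNx_1.
have h3 : expR y * expR (- y) = 1 by exact: expRxMexpNx_1.
have h4 : 1 <= expR x by rewrite -expR0 ler_expR.
have h5 := expR_gt0 (- y); have h6 := expR_gt0 (- x).
have h7 : expR (- x) <= 1 by nra.
have h8 : expR (- y) < 1 by rewrite expR_lt1 oppr_lt0.
have h9 : expR (- x) * expR (- y) < 1 by nra.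
have h10 : expR (- x) - expR (- y) = expR (- x) * expR (- y) * (expR y - expR x).
  by rewrite mulrBr -!mulrA [expR (- y) * _]mulrC h3 mulr1 [expR (- y) * _]mulrC mulrA
    [expR (- x) * _]mulrC h2 mul1r.
nra.
Qed.

End hyperbolic_inverse.

(** * Limit of the Laplace transforms and conclusion *)

Section Gamma_laplace.
Context d (T : measurableType d) {R : realType} (P : probability T R).
Local Notation RT := (measurableTypeR R).
Variables (B : R -> T -> R) (beta lam t : R).
Hypothesis bmB : brownian_motion P B.
Hypothesis beta0 : 0 < beta.
Hypothesis lam0 : 0 <= lam.
Hypothesis t0 : 0 < t.

Let G n : T -> R := rec_chain
  (fun k w => B (k.+1%:R * (t / n.+1%:R)) w - B (k%:R * (t / n.+1%:R)) w : RT)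
  (Gamma_step beta (t / n.+1%:R)) 1 n.+1.

(** Measurability of [Gamma_proc] in [w] is obtained only off a null set, as a limit of chains. The
    integral is therefore first replaced by that of the restriction to the complement, to which
    dominated convergence applies. *)
Lemma Gamma_laplace_cvg :
  (\int[P]_w (expR (- lam * Gamma_proc beta B t w))%:E \is a fin_num)%E /\
  (fun n => \int[P]_w (expR (- (G n w * lam)))%:E)%E @ \oo -->
  (\int[P]_w (expR (- lam * Gamma_proc beta B t w))%:E)%E.
Proof.
have hn0 n : 0 < t / n.+1%:R by rewrite divr_gt0.
have mG n : measurable_fun setT (G n).
  apply: (measurable_rec_chain 1 (brownian_increments_iid (hn0 n) bmB)).
  exact: measurable_Gamma_step.
have G0 n w : 0 <= G n w.
  (* The mesh is abstracted first, so that the induction on the number of steps does not change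
     it. *)
  rewrite /G; move: (t / n.+1%:R) (hn0 n) => h h0.
  by elim: n.+1 => //= k IH; exact: Gamma_step_ge0.
have [_ [N [mN N0 subN]] _ _] := bmB.
have cvgG w : ~ N w -> G ^~ w @ \oo --> Gamma_proc beta B t w.
  move=> nNw; have [B0 cB] : B 0 w = 0 /\ {within [set t | 0 <= t], continuous (fun t => B t w)}.
    by apply: contrapT => H; apply: nNw; exact: subN.
  exact: Gamma_chain_cvg.
pose f w := (expR (- lam * Gamma_proc beta B t w))%:E.
pose fn n w := (expR (- (G n w * lam)))%:E.
have mfn n : measurable_fun setT (fn n).
  apply/measurable_EFinP; apply: (measurableT_comp (@measurable_expR R)).
  by apply: measurable_funN; apply: measurable_funM => //; exact: mG.
have fnf w : ~ N w -> fn ^~ w @ \oo --> f w.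
  move=> nNw; apply: cvg_EFin; first exact: nearW.
  apply: (cvg_comp _ expR); last exact: continuous_expR.
  rewrite mulNr mulrC; apply: cvgN; apply: cvgM; last exact: cvg_cst.
  exact: cvgG.
have mCN : measurable (~` N) by exact: measurableC.
have mf : measurable_fun setT (f \_ (~` N)).
  apply: (emeasurable_fun_cvg (fun n => fn n \_ (~` N))).
    by move=> n; apply/(measurable_restrictT _ mCN); exact: measurable_funTS.
  move=> w _; have [Nw|nNw] := pselect (N w).
    rewrite (_ : (fun n => _) = cst 0%E); first by rewrite patchE ifF ?in_setC ?mem_set//; exact: cvg_cst.
    by apply/funext => n; rewrite patchE ifF// in_setC mem_set.
  rewrite (_ : (fun n => _) = fn ^~ w); last first.
    by apply/funext => n; rewrite patchE ifT// inE.
  by rewrite patchE ifT ?inE//; exact: fnf.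
have f0 w : (0 <= f w)%E by rewrite lee_fin expR_ge0.
rewrite (ge0_integral_restrict_null mN N0 f0 mf).
have [|||intf _ cvgf] := @dominated_convergence _ _ _ P setT measurableT
  fn (f \_ (~` N)) (cst 1%E) mfn mf.
- exists N; split => // w /= /not_implyP[_]; apply: contra_notP => nNw.
  by rewrite patchE ifT ?inE//; exact: fnf.
- by apply: finite_measure_integrable_cst.
- apply: aeW => w n _; rewrite gee0_abs ?lee_fin ?expR_ge0//.
  by rewrite expR_le1 oppr_le0 mulr_ge0.
- by split; [exact: integrable_fin_num|].
Qed.

End Gamma_laplace.

Lemma bessel_potential_small (R : realType) (beta : R) : 0 < beta ->
  forall e, 0 < e -> \forall j \near \oo, bessel_potential beta (j.+1%:R^-1) <= e.
Proof.
move=> beta0 e e0; have c0 : 0 < e / (beta * expR 1).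
  by rewrite divr_gt0// mulr_gt0// expR_gt0.
have := near_infty_natSinv_lt (PosNum c0); apply: filterS => j /=.
set y := _^-1 => yc.
have y0 : 0 <= y by rewrite invr_ge0.
have y1 : y <= 1 by rewrite invf_le1// ler1n.
have ny : `|y| <= 1 by rewrite ger0_norm.
have nyN : `|- y| <= 1 by rewrite normrN.
have [_ a1] := ler_normlW2 (normr_expRB1Dx_le ny).
have [_ a2] := ler_normlW2 (normr_expRB1Dx_le nyN).
rewrite sqrrN in a2.
have yy : y ^+ 2 * expR 1 <= y * expR 1.
  by rewrite ler_wpM2r ?expR_ge0// expr2 ler_piMr.
rewrite ltr_pdivlMr ?mulr_gt0 ?expR_gt0// in yc.
have cy : coshR y - 1 <= y * expR 1 by rewrite /coshR; clear -a1 a2 yy; lra.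
have : beta * (coshR y - 1) <= beta * (y * expR 1) by rewrite ler_wpM2l// ltW.
by rewrite /bessel_potential; move=> /le_trans; apply; rewrite mulrCA ltW.
Qed.

Lemma near_sqrt_mesh_le (R : realType) (t C e : R) : 0 < t -> 0 <= C -> 0 < e ->
  \forall n \near \oo, n.+1%:R * (C * (t / n.+1%:R * Num.sqrt (t / n.+1%:R))) <= e.
Proof.
(* The [n.+1] errors add up to [C t sqrt (t / n.+1)]; the added 1 keeps the divisor positive when
   [C = 0]. *)
move=> t0 C0 e0; have k0 : 0 < C * t + 1 by rewrite ltr_wpDl// mulr_ge0// ltW.
have d0 : 0 < (e / (C * t + 1)) ^+ 2 by rewrite exprn_gt0// divr_gt0.
have := near_mesh_lt t d0; apply: filterS => n hn.
have sq : Num.sqrt (t / n.+1%:R) <= e / (C * t + 1).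
  rewrite -(ger0_norm (ltW (divr_gt0 e0 k0))) -sqrtr_sqr ler_sqrt ?ltW//.
rewrite ler_pdivlMr// in sq.
have s0 := sqrtr_ge0 (t / n.+1%:R).
set s := Num.sqrt _ in sq s0 *.
rewrite [leLHS](_ : _ = C * (n.+1%:R * (t / n.+1%:R)) * s); last by ring.
rewrite [n.+1%:R * _]mulrC divfK ?pnatr_eq0//.
apply: le_trans sq; rewrite mulrC ler_wpM2l// lerDl//.
Qed.

Lemma integral01_fin_num d (T : measurableType d) (R : realType)
    (P : probability T R) (f : T -> R) : measurable_fun setT f ->
  (forall w, 0 <= f w <= 1) -> (\int[P]_w (f w)%:E \is a fin_num)%E.
Proof.
move=> mf f01; apply: integrable_fin_num => //.
apply: measurable_bounded_integrable => //; first by rewrite [X in (X < _)%E](probability_setT P) ltry.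
exists 1; split; first exact: num_real.
move=> M M1 w _; have /andP[f0 f1] := f01 w.
by rewrite /= ger0_norm// (le_trans f1)// ltW.
Qed.

Lemma laplace_duality_gt0 (R : realType)
    (d : measure_display) (Omega : measurableType d) (P : probability Omega R)
    (B : R -> Omega -> R)
    (d' : measure_display) (Omega' : measurableType d') (Q : probability Omega' R)
    (W X : R -> Omega' -> R)
    (beta lambda t : R) :
  brownian_motion P B ->
  0 < beta ->
  hyperbolic_bessel Q (-1) W X ->
  {ae Q, forall w, coshR (X 0 w) = lambda / beta + 1} ->
  0 <= lambda -> 0 < t ->
  (\int[P]_w (expR (- lambda * Gamma_proc beta B t w))%:E
   = \int[Q]_w (expR (- beta * (coshR (X t w) - 1)))%:E)%E.
Proof.
move=> bmB beta0 [bmW mX aeX] aeX0 lam0 t0.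
have hn0 n : 0 < t / n.+1%:R by rewrite divr_gt0.
have c1 : 1 <= lambda / beta + 1 by rewrite lerDr divr_ge0// ltW.
have [x0 x0_ge0 cx0] := coshR_surj c1.
have phix0 : bessel_potential beta x0 = lambda.
  by rewrite /bessel_potential cx0 addrK mulrC divfK// gt_eqF.
pose eps j : R := j.+1%:R^-1.
have eps0 j : 0 < eps j by rewrite invr_gt0.
pose Z n : nat -> Omega' -> measurableTypeR R :=
  fun k w => W (k.+1%:R * (t / n.+1%:R)) w - W (k%:R * (t / n.+1%:R)) w.
pose F j n w : R := stopped_payoff beta (eps j)
  (rec_chain (Z n) (Euler_step (eps j) (t / n.+1%:R)) x0 n.+1 w).
pose tgt w : R := expR (- bessel_potential beta (X t w)).
have iidW n := brownian_increments_iid (hn0 n) bmW.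
have mF j n : measurable_fun setT (F j n).
  apply: (measurableT_comp (measurable_stopped_payoff beta (eps j))).
  exact: (measurable_rec_chain x0 (iidW n) (measurable_Euler_step _ _)).
have mtgt : measurable_fun setT tgt.
  apply: (measurableT_comp (@measurable_expR R)); apply: measurable_funN.
  exact: measurableT_comp (measurable_potential beta) (mX t).
have phi0 := bessel_potential_ge0 beta0.
have F01 j n w : 0 <= F j n w <= 1.
  rewrite /F /stopped_payoff; case: ifPn => _; last by rewrite ler01 lexx.
  by rewrite expR_ge0 expR_le1 oppr_le0 phi0.
have tgt01 w : 0 <= tgt w <= 1 by rewrite expR_ge0 expR_le1 oppr_le0 phi0.
pose D j n w := `|F j n w - tgt w|.
have mD j n : measurable_fun setT (D j n).
  by apply: (measurableT_comp (@normr_measurable R setT)); exact: measurable_funB.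
have D01 j n w : 0 <= D j n w <= 1.
  have /andP[a1 a2] := F01 j n w; have /andP[b1 b2] := tgt01 w.
  by rewrite normr_ge0 ler_norml; apply/andP; split; clear -a1 a2 b1 b2; lra.
have aeD : {ae Q, forall w, \forall j \near \oo, D j n w @[n --> \oo] --> (0 : R)}.
  have [_ aeW _ _] := bmW.
  apply: filterS3 aeX aeW aeX0 => w [cX X_ge0 Xabs XE] [W0 _] cXw0.
  (* As [cosh] is injective on nonnegative reals, almost every path starts at the deterministic [x0]
     from which the chain is run. *)
  have Xw0 : X 0 w = x0 by apply: coshR_inj_ge0 => //; [exact: X_ge0|rewrite cXw0].
  have [e1 e10 e1P] := Euler_payoff_cvg beta0 t0 W0 cX X_ge0 Xabs XE.
  have := near_infty_natSinv_lt (PosNum e10); apply: filterS => j /= je.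
  have := e1P (eps j) (eps0 j) (ltW je); rewrite Xw0 => Fcvg.
  rewrite -(normr0 R) -(subrr (tgt w)).
  by apply: cvg_norm; apply: cvgB; [exact: Fcvg|exact: cvg_cst].
have iter := integral_iterated_limit0 mD D01 aeD.
have [Lfin Lcvg] := Gamma_laplace_cvg bmB beta0 lam0 t0.
have -> : (\int[Q]_w (expR (- beta * (coshR (X t w) - 1)))%:E =
    \int[Q]_w (tgt w)%:E)%E.
  by apply: eq_integral => w _; rewrite mulNr.
set L := (\int[P]_w _)%E in Lfin Lcvg *.
have rfin := integral01_fin_num Q mtgt tgt01.
set r := (\int[Q]_w _)%E in rfin *.
rewrite -(fineK Lfin) -(fineK rfin); congr EFin.
(* The budget [e = 4 eta] is spent on four errors: [L] against [u n], the stopping cost, the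
   accumulated kernel error, and the distance [del] between [A] and [r]. *)
apply/eqP; rewrite -subr_eq0 -normr_le0; apply/ler_addgt0Pr => e e0; rewrite add0r.
pose eta := e / 4.
have eta0 : 0 < eta by rewrite divr_gt0.
(* The order matters: [j] is fixed first, since the constant [C] depends on [eps j], and only then
   is [n] taken large. *)
have [j [iterj phij]] := @filter_ex _ _ _ _
  (filterI (iter eta eta0) (bessel_potential_small beta0 eta0)).
have [C C0 CP] := duality_kernel_le (eps0 j) beta0.
pose u n := (\int[P]_w (expR (- (rec_chain
  (fun k w => B (k.+1%:R * (t / n.+1%:R)) w - B (k%:R * (t / n.+1%:R)) w
     : measurableTypeR R)
  (Gamma_step beta (t / n.+1%:R)) 1 n.+1 w * lambda)))%:E)%E.
have Lnear : \forall n \near \oo, u n \is a fin_num /\ `|fine L - fine (u n)| < eta.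
  move: Lcvg; rewrite -(fineK Lfin) => /fine_cvgP[ufin /cvgrPdist_lt /(_ _ eta0) ucvg].
  exact: filterI ufin ucvg.
have [n [[iterjn [ufin Ln]] [h1 Ch]]] := @filter_ex _ _ _ _
  (filterI (filterI iterj Lnear)
     (filterI (near_mesh_lt t ltr01) (near_sqrt_mesh_le t0 C0 eta0))).
have iidB := brownian_increments_iid (hn0 n) bmB.
have CPn x g := CP (t / n.+1%:R) x g (hn0 n) (ltW h1).
have le := discrete_duality_le beta0 (hn0 n) C0 CPn iidB (iidW n) x0_ge0 n.+1.
have ge := discrete_duality_ge beta0 (hn0 n) C0 CPn iidB (iidW n) x0 n.+1.
rewrite phix0 in le ge.
have Afin := integral01_fin_num Q (mF j n) (F01 j n).
have Dfin := integral01_fin_num Q (mD j n) (D01 j n).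
set A := (\int[Q]_w (F j n w)%:E)%E in Afin.
set del := (\int[Q]_w (D j n w)%:E)%E in iterjn Dfin.
have Ar : (A <= r + del)%E.
  rewrite -ge0_integralD//; last 4 first.
  - by move=> w _; rewrite lee_fin expR_ge0.
  - exact/measurable_EFinP.
  - by move=> w _; rewrite lee_fin normr_ge0.
  - exact/measurable_EFinP.
  apply: ge0_le_integral => //.
  - by move=> w _; rewrite lee_fin; have /andP[] := F01 j n w.
  - exact/measurable_EFinP.
  - by apply: emeasurable_funD; exact/measurable_EFinP.
  - move=> w _; rewrite -EFinD lee_fin -lerBlDl; exact: ler_norm.
have rA : (r <= A + del)%E.
  rewrite -ge0_integralD//; last 4 first.
  - by move=> w _; rewrite lee_fin; have /andP[] := F01 j n w.
  - exact/measurable_EFinP.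
  - by move=> w _; rewrite lee_fin normr_ge0.
  - exact/measurable_EFinP.
  apply: ge0_le_integral => //.
  - by move=> w _; rewrite lee_fin expR_ge0.
  - exact/measurable_EFinP.
  - by apply: emeasurable_funD; exact/measurable_EFinP.
  - move=> w _; rewrite -EFinD lee_fin -lerBlDl /D distrC; exact: ler_norm.
have Au : (A <= u n + (bessel_potential beta (eps j) +
    n.+1%:R * (C * (t / n.+1%:R * Num.sqrt (t / n.+1%:R))))%:E)%E by exact: le.
have uA : (u n <= A + (n.+1%:R * (C * (t / n.+1%:R *
    Num.sqrt (t / n.+1%:R))))%:E)%E by exact: ge.
rewrite -(fineK Afin) -(fineK ufin) -(fineK Dfin) -(fineK rfin) -!EFinD ?lee_fin ?lte_fin
  in Ar rA Au uA iterjn *.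
move: phij; rewrite -/(eps j) => phij.
have [l1 l2] := ler_normlW2 (ltW Ln).
have etaE : e = 4 * eta by rewrite /eta; field.
rewrite ler_norml; apply/andP.
set p := bessel_potential _ _ in phij Au.
set q := _ * (C * _) in Ch Au uA.
by rewrite etaE; split; clear -Ar rA Au uA iterjn phij Ch l1 l2; lra.
Qed.

Theorem theorem2p4 (R : realType)
    (d : measure_display) (Omega : measurableType d) (P : probability Omega R)
    (B : R -> Omega -> R)
    (d' : measure_display) (Omega' : measurableType d') (Q : probability Omega' R)
    (W X : R -> Omega' -> R)
    (beta lambda t : R) :
  brownian_motion P B ->
  0 < beta ->
  hyperbolic_bessel Q (-1) W X ->
  {ae Q, forall w, coshR (X 0 w) = lambda / beta + 1} ->
  0 <= lambda -> 0 <= t ->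
  (\int[P]_w (expR (- lambda * Gamma_proc beta B t w))%:E
   = \int[Q]_w (expR (- beta * (coshR (X t w) - 1)))%:E)%E.
Proof.
(* Time 0 is separate because the mesh [t / n.+1] has to be positive; there both sides equal
   [expR (- lambda)]. *)
move=> bmB beta0 hbX aeX0 lam0; rewrite le_eqVlt => /predU1P[<-|t0]; last first.
  exact: laplace_duality_gt0 bmB beta0 hbX aeX0 lam0 t0.
have [mB aeB _ _] := bmB; have [_ mX _] := hbX.
have Gamma0 w : Gamma_proc beta B 0 w = expR (B 0 w).
  by rewrite /Gamma_proc set_itv1 integral_set1 mul0r mulr0 addr0 divr1 subr0.
under eq_integral do rewrite Gamma0.
transitivity (\int[P]_w (cst (expR (- lambda))%:E w))%E.
  apply: ae_eq_integral => //.
    apply/measurable_EFinP; apply: (measurableT_comp (@measurable_expR R)).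
    apply: measurable_funM; first exact: measurable_cst.
    exact: measurableT_comp (@measurable_expR R) (mB 0).
  by apply: filterS aeB => w [-> _] _; rewrite expR0 mulr1.
transitivity (\int[Q]_w (cst (expR (- lambda))%:E w))%E.
  by rewrite (integral_probability_cst P) (integral_probability_cst Q).
apply: ae_eq_integral => //.
  apply/measurable_EFinP; apply: (measurableT_comp (@measurable_expR R)).
  apply: measurable_funM; first exact: measurable_cst.
  apply: measurable_funB; last exact: measurable_cst.
  exact: measurableT_comp measurable_coshR (mX 0).
apply: filterS aeX0 => w -> _ /=.
by rewrite addrK mulNr [beta * _]mulrC divfK// gt_eqF.
Qed.
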